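(* Let $G$ be a finite group. Every $G$-cobordism whose quotient is a torus or a Klein bottle (i.e. every principal $G$-bundle $Q\to M$ with $M$ a torus or a Klein bottle) is extendable. Moreover, any $G$-cobordism over the real projective plane $\mathbb{R}P^2$ associated with an element $x\in G$ satisfying $x^2=1$ and $x\neq 1$ is also extendable.
   Context: Here a closed two-dimensional $G$-cobordism is (the class of) a principal $G$-bundle $Q\to M$ over a closed, not necessarily orientable, surface $M$; equivalently a closed surface $Q$ with a free $G$-action and quotient $M$. It is called extendable if there exist a compact $3$-manifold $W$ with $\partial W\cong Q$ and an action of $G$ on $W$ (not necessarily free, and $W$ not necessarily orientable) that extends the action on $Q$. The $G$-cobordism over $\mathbb{R}P^2$ associated with $x\in G$, $x^2=1$, is the principal $G$-bundle over $\mathbb{R}P^2$ whose monodromy along the core circle of the Möbius strip obtained by removing an open disc from $\mathbb{R}P^2$ (the generator of $\pi_1(\mathbb{R}P^2)\cong\mathbb{Z}_2$) is $x$. Here a principal $G$-bundle over the circle has monodromy $x$ if it is isomorphic to $[0,1]\times G$ with $(0,y)$ identified with $(1,xy)$ for all $y\in G$, with $G$ acting by right multiplication on the second coordinate. *)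

(* Defs.v *)
From HB Require Import structures.
From Stdlib Require Import Relation_Operators.
From mathcomp Require Import all_boot all_order all_algebra all_fingroup.
From mathcomp Require Import generic_quotient.
From mathcomp Require Import all_classical all_reals topology normedtype.

Set Implicit Arguments.
Unset Strict Implicit.
Unset Printing Implicit Defensive.

Import Order.TTheory GRing.Theory Num.Theory.
Import numFieldNormedType.Exports.

Local Open Scope classical_set_scope.
Local Open Scope ring_scope.
Local Open Scope quotient_scope.

Section Homeomorphism.
Context {X Y : topologicalType}.

Definition homeomorphism (A : set X) (B : set Y) (f : X -> Y) : Prop :=
  [/\ set_bij A B f, {within A, continuous f}
    & exists2 g : Y -> X, {within B, continuous g} & {in A, cancel f g}].

Definition homeomorphic : Prop :=
  exists f : X -> Y, homeomorphism [set: X] [set: Y] f.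

End Homeomorphism.
Arguments homeomorphic : clear implicits.

(* The quotient space of X by the equivalence relation generated by r. *)
Section Glue.
Context {X : topologicalType} (r : X -> X -> Prop).

Definition glue_eq (a b : X) : bool := `[< clos_refl_sym_trans X r a b >].

Lemma glue_eq_refl : reflexive glue_eq.
Proof. by move=> a; apply/asboolP; exact: rst_refl. Qed.

Lemma glue_eq_sym : symmetric glue_eq.
Proof. by move=> a b; apply/asboolP/asboolP; exact: rst_sym. Qed.

Lemma glue_eq_trans : transitive glue_eq.
Proof. by move=> b a c /asboolP ab /asboolP bc; apply/asboolP/(rst_trans _ _ _ b). Qed.

Definition glue_equiv := EquivRel glue_eq glue_eq_refl glue_eq_sym glue_eq_trans.

Definition glue := {eq_quot glue_equiv}.

HB.instance Definition _ := Topological.copy glue (quotient_topology glue).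
HB.instance Definition _ := Quotient.on glue.

Definition glue_pi : X -> glue := \pi_glue.

End Glue.

Section Surfaces.
Variable R : realType.

Definition unit_interval : Type := set_type `[0 : R, 1]%classic.

Lemma half_unit_interval : (2^-1 : R) \in `[0 : R, 1]%classic.
Proof.
by rewrite mem_setE in_itv /= invr_ge0 ler0n invf_le1 ?ltr0n// ler1n.
Qed.

Definition half : unit_interval := SigSub half_unit_interval.

Definition edge (flip : bool) (s t : unit_interval) : Prop :=
  \val t = (if flip then 1 - \val s else \val s).

(* Opposite sides of the square are identified,
     (0, t) ~ (1, t), or (0, t) ~ (1, 1 - t) if flipv,
     (s, 0) ~ (s, 1), or (s, 0) ~ (1 - s, 1) if fliph. *)
Definition square_side (flipv fliph : bool)
    (a b : unit_interval * unit_interval) : Prop :=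
  [/\ \val a.1 = 0, \val b.1 = 1 & edge flipv a.2 b.2] \/
  [/\ \val a.2 = 0, \val b.2 = 1 & edge fliph a.1 b.1].

Definition torus := glue (square_side false false).
Definition klein_bottle := glue (square_side true false).
Definition projective_plane := glue (square_side true true).

(* The image of [0, 1] x [1/4, 3/4] in the projective plane is a Moebius strip,
   since (0, t) ~ (1, 1 - t), and the complement of this strip is an open disc.
   The loop below parametrizes the core circle of the strip. *)
Definition core_circle (t : unit_interval) : projective_plane :=
  glue_pi (square_side true true) (t, half).

Definition mapping_torus_side (gT : finGroupType) (x : gT)
    (a b : unit_interval * discrete_topology gT) : Prop :=
  [/\ \val a.1 = 0, \val b.1 = 1 & b.2 = (x * a.2)%g :> gT].

Definition mapping_torus (gT : finGroupType) (x : gT) :=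
  glue (mapping_torus_side x).

End Surfaces.

Section Bundles.
Context {gT : finGroupType} {Q M : topologicalType}.

(* {action gT &-> Q} is a right action. *)
Definition continuous_action (to : {action gT &-> Q}) : Prop :=
  forall g, continuous (to^~ g).

Definition principal_bundle (to : {action gT &-> Q}) (p : Q -> M) : Prop :=
  [/\ continuous_action to, continuous p, forall q g, p (to q g) = p q
    & forall m, exists2 U : set M, open_nbhs m U &
      exists phi : Q -> M * discrete_topology gT,
      [/\ homeomorphism (p @^-1` U) (U `*` setT) phi,
          {in p @^-1` U, forall q, (phi q).1 = p q}
        & {in p @^-1` U, forall q g, (phi (to q g)).2 = ((phi q).2 * g)%g}]].

(* For a simple closed curve gamma in M, parametrized by [0, 1], the restriction
   of the principal bundle p to the circle (range gamma) is isomorphic to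
   [0, 1] x G / (0, y) ~ (1, x y). *)
Definition has_monodromy (R : realType) (to : {action gT &-> Q}) (p : Q -> M)
    (gamma : unit_interval R -> M) (x : gT) : Prop :=
  exists f : mapping_torus R x -> Q,
  [/\ homeomorphism setT (p @^-1` range gamma) f,
      forall t (y : gT),
        p (f (glue_pi (mapping_torus_side x) (t, y))) = gamma t
    & forall t (y g : gT),
        f (glue_pi (mapping_torus_side x) (t, (y * g)%g)) =
        to (f (glue_pi (mapping_torus_side x) (t, y))) g].

End Bundles.

(* Topological (n+1)-manifolds with boundary. *)
Section Manifolds.
Context {R : realType} {n : nat} {W : topologicalType}.

Definition half_space : set 'rV[R]_n.+1 := [set v | 0 <= v ord0 ord0].

Record boundary_chart : Type := BoundaryChart {
  chart_dom : set W;
  chart_map : W -> 'rV[R]_n.+1;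
  chart_open : open chart_dom;
  chart_homeo : exists2 V : set 'rV[R]_n.+1, open V &
    homeomorphism chart_dom (V `&` half_space) chart_map }.

Definition manifold_with_boundary (A : set boundary_chart) : Prop :=
  [/\ hausdorff_space W, second_countable (T := W)
    & forall w, exists2 c, A c & chart_dom c w].

(* By invariance of domain, this set does not depend on the choice of the atlas
   A: a point is either in the boundary for all charts around it or for none. *)
Definition boundary (A : set boundary_chart) : set W :=
  [set w | exists2 c, A c & chart_dom c w /\ chart_map c w ord0 ord0 = 0].

End Manifolds.
Arguments boundary_chart : clear implicits.

Definition extendable (R : realType) (gT : finGroupType) (Q : topologicalType)
    (to : {action gT &-> Q}) : Prop :=
  exists (W : topologicalType) (A : set (boundary_chart R 2 W))
         (toW : {action gT &-> W}) (j : Q -> W),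
  [/\ manifold_with_boundary A, compact [set: W], continuous_action toW,
      homeomorphism [set: Q] (boundary A) j
    & forall q g, j (to q g) = toW (j q) g].

(* Main.v *)
(* A circle bundle is filled by disc bundles. The unrolling E of the torus, or of
   the Klein bottle, from R^2 satisfies E(x + 1, sigma y) = E(x, y + 1) = E(x, y),
   with sigma = 1 or -1. It lifts to a map s from R^2 to the total space Q, and
   s(x + 1, sigma y) = s(x, y) a, s(x, y + 1) = s(x, y) b for constants a and b.
   Hence Q is the quotient of S^1 x S^1 x G by a finite group acting freely, which
   is generated by (z, w, g) |-> (z', w e(1/m), a^-1 g), where z' is z or its
   conjugate, and (z, w, g) |-> (z e(1/n), w, b^-1 g). These formulas make sense
   for z in the disc, and the quotient W of D^2 x S^1 x G has boundary Q. If n is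
   the order of b, the action remains free, so that W is a manifold.
   Over the projective plane, Q is the quotient of S^2 x G by
   (v, g) |-> (- v, k^-1 g) with k conjugate to x. As k <> 1, this involution is
   free on B^3 x G, and the quotient of B^3 x G has boundary Q. *)
From HB Require Import structures.
From Stdlib Require Import Relation_Operators.
From mathcomp Require Import all_boot all_order all_algebra all_fingroup.
From mathcomp Require Import cyclic generic_quotient ring lra.
From mathcomp Require Import all_classical all_reals topology normedtype.
From mathcomp Require Import realfun trigo.
Require Import Defs.

Set Implicit Arguments.
Unset Strict Implicit.
Unset Printing Implicit Defensive.

Import Order.TTheory GRing.Theory Num.Theory.
Import numFieldNormedType.Exports.

Local Open Scope classical_set_scope.
Local Open Scope ring_scope.

(** * Charts of manifolds with boundary *)

(** The bundle is known only through local trivialisations, so [Q] is reached through lifts of maps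
    of the plane. Two lifts of one map differ by a constant of [G]; this produces [a], [b] and [k],
    and no fundamental group is needed. The topology of [Q] is recovered from the same lifts: the
    unrolled square is a quotient map onto the base, hence the translates of its lift detect the
    open sets of [Q]. All cases then meet in one criterion, [extendable_free_quotient]. The disc
    fills the circle of direction y because the steps of the plane preserve this direction up to
    sign: they act on that circle by rotations and reflections, which extend linearly to the disc.
    The obstacle is the core, where every rotation of the disc has a fixed point. There, only the
    circle factor and the factor [G] can keep the action free, and this dictates the orders [m] and
    [n]. At the centre of the ball only [G] remains. Therefore [k] must be shown nontrivial, which
    is done by comparing the lift along the core circle with the given monodromy. *)

Lemma cvg_openP (S T : topologicalType) (f : S -> T) x :
  {for x, continuous f} <->
  forall O, open O -> O (f x) ->
    exists U, [/\ open U, U x & forall y, U y -> O (f y)].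
Proof.
split=> [fx O oO Ox|fx A].
  have : nbhs x (f @^-1` O) by apply: fx; exact: open_nbhs_nbhs.
  by rewrite nbhsE => -[U [oU Ux] UO]; exists U.
rewrite nbhsE => -[O [oO Ox] OA]; have [U [oU Ux UO]] := fx O oO Ox.
apply: (@filterS _ _ _ U); last exact: open_nbhs_nbhs.
by move=> y /UO /OA.
Qed.

Lemma within_openP (S T : topologicalType) (A : set S) (f : S -> T) :
  {within A, continuous f} <->
  forall x O, A x -> open O -> O (f x) ->
    exists U, [/\ open U, U x & forall y, U y -> A y -> O (f y)].
Proof.
rewrite subspace_continuousP; split=> [fc x O Ax oO Ox|fc x Ax B].
  have : (f @ within A (nbhs x)) O by apply: fc => //; exact: open_nbhs_nbhs.
  rewrite /= /within/= nbhsE => -[U [oU Ux] UO]; by exists U; split.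
rewrite nbhsE => -[O [oO Ox] OB]; have [U [oU Ux UO]] := fc x O Ax oO Ox.
rewrite /= /within/= nbhsE; exists U => // y Uy Ay; exact/OB/UO.
Qed.

Lemma openP (T : topologicalType) (A : set T) :
  open A <-> forall x, A x -> exists U, [/\ open U, U x & U `<=` A].
Proof.
split=> [oA x Ax|h]; first by exists A; split.
rewrite openE => x /h[U [oU Ux UA]]; rewrite /interior nbhsE.
by exists U.
Qed.

Section Homeomorphisms.
Variables X Y : topologicalType.

Lemma homeomorphism_can (A : set X) (B : set Y) f g :
  (forall x, A x -> B (f x)) -> (forall y, B y -> A (g y)) ->
  (forall x, A x -> g (f x) = x) -> (forall y, B y -> f (g y) = y) ->
  {within A, continuous f} -> {within B, continuous g} ->
  homeomorphism A B f.
Proof.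
move=> fAB gBA fK gK fc gc; split=> //.
  split.
  - by move=> x /fAB.
  - by move=> x y /set_mem /fK xK /set_mem /fK yK /(congr1 g); rewrite xK yK.
  - by move=> y By; exists (g y); [exact: gBA|exact: gK].
by exists g => // x /set_mem /fK.
Qed.

Lemma homeomorphism_inv (A : set X) (B : set Y) f :
  homeomorphism A B f -> exists g,
  [/\ forall y, B y -> A (g y), forall x, A x -> g (f x) = x,
      forall y, B y -> f (g y) = y & {within B, continuous g}].
Proof.
move=> [[fAB _ fsurj] fc [g gc fK]].
have gK x : A x -> g (f x) = x by move=> Ax; apply/fK/mem_set.
exists g; split=> //.
- by move=> y /fsurj[x Ax <-]; rewrite gK.
- by move=> y /fsurj[x Ax <-]; rewrite gK.
Qed.

End Homeomorphisms.

Lemma within_comp (X Y Z : topologicalType) (A : set X) (B : set Y)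
    (f : X -> Y) (g : Y -> Z) :
  (forall x, A x -> B (f x)) -> {within A, continuous f} ->
  {within B, continuous g} -> {within A, continuous (g \o f)}.
Proof.
move=> fAB /within_openP fc /within_openP gc; apply/within_openP => x O Ax oO /=.
move=> /(gc _ _ (fAB _ Ax) oO)[V [oV Vfx VO]].
have [U [oU Ux UV]] := fc _ _ Ax oV Vfx.
exists U; split=> // y Uy Ay; apply: VO; [exact: UV|exact: fAB].
Qed.

Section ChartTransport.
Context {R : realType} {n : nat} {W Y : topologicalType}.

Lemma chart_transport (c : boundary_chart R n Y) (A : set W) (B : set Y)
    (f : W -> Y) :
  open A -> open B -> B `<=` chart_dom c -> homeomorphism A B f ->
  exists c' : boundary_chart R n W,
    chart_dom c' = A /\ chart_map c' = chart_map c \o f.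
Proof.
move=> oA oB Bc fAB.
suff h : exists2 V : set 'rV[R]_n.+1, open V &
    homeomorphism A (V `&` half_space) (chart_map c \o f).
  by exists (@BoundaryChart R n W A (chart_map c \o f) oA h).
have [V oV Vh] := chart_homeo c.
have [k [kdom kK kK' kc]] := homeomorphism_inv Vh.
have [g [gA gK gK' gc]] := homeomorphism_inv fAB.
have [[fB _ _] fc _] := fAB.
have [[mV _ _] mc _] := Vh.
(* The image of the smaller chart has to be relatively open in the half-space: [V'] collects the
   open sets whose trace on the image of [c] is sent into [B] by the inverse [k]. *)
pose V' := V `&` \bigcup_(O in [set O | open O /\
  forall v, O v -> (V `&` half_space) v -> B (k v)]) O.
have V'sub v : (V' `&` half_space) v -> (V `&` half_space) v.
  by move=> [[]].
have V'B v : (V' `&` half_space) v -> B (k v).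
  by move=> [[Vv [O [_ OB] Ov]] Hv]; exact: OB.
have BV' y : B y -> (V' `&` half_space) (chart_map c y).
  move=> By; have [Vy Hy] := mV _ (Bc _ By).
  split=> //; split=> //; move/within_openP: kc.
  move=> /(_ (chart_map c y) B)[//|//||O [oO Oy OB]]; first by rewrite kK//; exact: Bc.
  by exists O.
exists V'; first by apply: openI => //; apply: bigcup_open => O [].
apply: (@homeomorphism_can _ _ _ _ _ (g \o k)).
- by move=> x Ax; exact/BV'/fB.
- by move=> v /V'B /gA.
- by move=> x Ax /=; rewrite kK ?gK//; exact/Bc/fB.
- by move=> v Vv /=; rewrite gK' ?kK'//; [exact: V'sub|exact: V'B].
- apply: within_comp fc _; first exact: fB.
  exact: continuous_subspaceW mc.
- apply: within_comp gc; first exact: V'B.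
  exact: continuous_subspaceW kc.
Qed.

(* The charts around which D is the boundary form an atlas with boundary D, so
   that only one such chart around each point is needed. *)
Definition charted (D : set W) : Prop :=
  forall w, exists c : boundary_chart R n W,
    chart_dom c w /\
    forall w', chart_dom c w' -> (chart_map c w' ord0 ord0 = 0 <-> D w').

Lemma charted_manifold (D : set W) :
  hausdorff_space W -> second_countable (T := W) -> charted D ->
  exists2 A : set (boundary_chart R n W),
    manifold_with_boundary A & boundary A = D.
Proof.
move=> hW sW cD.
exists [set c | forall w', chart_dom c w' ->
    (chart_map c w' ord0 ord0 = 0 <-> D w')].
  by split=> // w; have [c [cw cD']] := cD w; exists c.
rewrite /boundary eqEsubset; split=> w /=.
  by move=> [c cD' [cw /cD']]; exact.
move=> Dw; have [c [cw cD']] := cD w; exists c => //; split=> //.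
exact/cD'.
Qed.

End ChartTransport.
Arguments charted {R} n {W} D.

Lemma continuous_pair (S T U : topologicalType) (f : S -> T) (g : S -> U) x :
  {for x, continuous f} -> {for x, continuous g} ->
  {for x, continuous (fun y => (f y, g y))}.
Proof. by move=> fx gx; exact: (cvg_pair fx gx). Qed.

Section Glue.
Context {X : topologicalType} (r : X -> X -> Prop).

Lemma glue_piP x y : glue_pi r x = glue_pi r y <-> glue_eq r x y.
Proof. by split=> [/eqmodP|?]; [|exact/eqmodP]. Qed.

Lemma glue_eqP x y : glue_eq r x y <-> clos_refl_sym_trans X r x y.
Proof. by split=> /asboolP. Qed.

Lemma glue_pi_surj (w : glue r) : exists x, glue_pi r x = w.
Proof. by exists (repr w); exact: reprK. Qed.

Lemma glue_pi_continuous : continuous (glue_pi r).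
Proof. exact: pi_continuous. Qed.

Lemma open_glue (O : set (glue r)) : open (glue_pi r @^-1` O) -> open O.
Proof. by []. Qed.

End Glue.

Section Discrete.
Variables (Y : topologicalType) (gT : finGroupType).

Lemma open_slice (U : set Y) (g : discrete_topology gT) :
  open U -> open (U `*` [set g]).
Proof.
move=> oU; apply/openP => -[y h] [/= Uy ->].
exists (U `*` [set g]); split=> //.
rewrite openE => -[y' h'] [/= Uy' ->].
exists (U, [set g]) => //=; split; first exact: open_nbhs_nbhs.
exact: discrete_set1.
Qed.

Lemma open_slice_sub (O : set (Y * discrete_topology gT)) y g :
  open O -> O (y, g) ->
  exists U, [/\ open U, U y & forall y', U y' -> O (y', g)].
Proof.
rewrite openE => oO /oO [[A B] /= [Ay Bg] AB].
move: Ay; rewrite nbhsE => -[U [oU Uy] UA]; exists U; split=> // y' Uy'.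
by apply: AB; split; [exact: UA|exact: nbhs_singleton].
Qed.

End Discrete.

(** * Quotients by free actions of finite groups *)

Lemma open_forall (X : topologicalType) (I : finType) (U : I -> set X) :
  (forall i, open (U i)) -> open [set x | forall i, U i x].
Proof.
move=> oU; rewrite openE => x Ux.
by apply: filter_forall => i; apply: open_nbhs_nbhs.
Qed.

Section FreeQuotient.
Context {R : realType} {gT : finGroupType} {n : nat} {Y : topologicalType}.
Local Notation X := (Y * discrete_topology gT)%type.
Variables (D : set Y) (r : X -> X -> Prop) (I : finType) (T : I -> X -> X).
Hypothesis T_cont : forall i, continuous (T i).
Hypothesis glue_T : forall x y, glue_eq r x y <-> exists i, y = T i x.
(** Freeness in a form that asks for no group structure on [I]: a [T i] with a fixed point is the
    identity map. *)
Hypothesis T_free : forall i x, T i x = x -> forall y, T i y = y.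
Hypothesis T_D : forall i x, D x.1 -> D (T i x).1.

Local Notation W := (glue r).
Local Notation pi := (glue_pi r).

(** The saturation of [U] is the union of its preimages under the [T i]; symmetry of [glue_eq]
    stands in for inverses of these maps. *)
Lemma glue_pi_open (U : set X) : open U -> open (pi @` U).
Proof.
move=> oU; apply: open_glue.
have -> : pi @^-1` (pi @` U) = \bigcup_(i in setT) (T i @^-1` U).
  rewrite eqEsubset; split=> [x [u Uu /esym/glue_piP/glue_T[i ui]]|x [i _ Ux]].
    by exists i => //; rewrite /preimage/= -ui.
  exists (T i x) => //; apply/esym/glue_piP/glue_T; by exists i.
by apply: bigcup_open => i _; move/continuousP: (@T_cont i); exact.
Qed.

Lemma quotient_boundary x : (exists2 x', D x'.1 & pi x' = pi x) <-> D x.1.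
Proof.
split=> [[x' Dx' /glue_piP/glue_T[i ->]]|Dx]; first exact: T_D.
by exists x.
Qed.

(** Used with [x'] in another orbit to separate points of the quotient, and with [x' = x] to make
    the projection locally injective. Equal group coordinates call for separation in [Y]; different
    ones are separated by slices of the discrete factor. *)
Lemma open_separation i x x' : hausdorff_space Y -> T i x <> x' ->
  exists UV : set X * set X,
  [/\ open UV.1, open UV.2, UV.1 x, UV.2 x' &
   forall u, UV.1 u -> UV.2 (T i u) -> False].
Proof.
move=> hY neq; have [e|/eqP e] := eqVneq (T i x).2 x'.2.
  have ne : (T i x).1 != x'.1.
    by apply/eqP => e'; apply: neq; case: (T i x) (x') e e' => ? ? [? ?] /= -> ->.
  move: hY; rewrite open_hausdorff => /(_ _ _ ne)[[A B] /= [/set_mem Ax /set_mem Bz]].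
  move=> [oA oB /eqP AB0].
  exists (T i @^-1` (A `*` setT), B `*` [set x'.2]); split=> //=.
  - move/continuousP: (@T_cont i); apply; apply/openP => u [Au _].
    exists (A `*` [set u.2]); split=> //; first exact: open_slice.
    by move=> u' [].
  - exact: open_slice.
  - move=> u [Au _] [Bu _].
    have : (A `&` B) (T i u).1 by [].
    by rewrite AB0.
exists (T i @^-1` (setT `*` [set (T i x).2]), setT `*` [set x'.2]); split=> //=.
- by move/continuousP: (@T_cont i); apply; apply: open_slice; exact: openT.
- by apply: open_slice; exact: openT.
- by move=> u [_ /= ue] [_ /= uh]; apply: e; rewrite -ue -uh.
Qed.

Lemma quotient_hausdorff : hausdorff_space Y -> hausdorff_space W.
Proof.
move=> hY; rewrite open_hausdorff => v w.
have [x <-] := glue_pi_surj v; have [x' <-] := glue_pi_surj w => /eqP vw.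
have neq i : T i x <> x'.
  by move=> e; apply: vw; apply/glue_piP/glue_T; exists i.
have [UV UVP] := choice (fun i => open_separation hY (neq i)).
pose U := [set u | forall i, (UV i).1 u].
pose V := [set u | forall i, (UV i).2 u].
exists (pi @` U, pi @` V) => /=.
  by rewrite !inE; split; [exists x|exists x'] => // i; have [] := UVP i.
split.
- by apply/glue_pi_open/open_forall => i; have [] := UVP i.
- by apply/glue_pi_open/open_forall => i; have [] := UVP i.
apply/eqP; rewrite -subset0 => z [[u Uu <-] [u' Vu']] /esym/glue_piP/glue_T[i e].
by have [_ _ _ _] := UVP i; apply; [exact: Uu|rewrite -e; exact: Vu'].
Qed.

(** The finitely many [T i] that move [x] also move a whole neighbourhood of [x] off itself, and by
    [T_free] the others are the identity. *)
Lemma glue_pi_locally_injective x : hausdorff_space Y ->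
  exists U, [/\ open U, U x &
    forall u u', U u -> U u' -> pi u = pi u' -> u = u'].
Proof.
move=> hY.
have h i : exists UV : set X * set X, [/\ open UV.1, open UV.2, UV.1 x, UV.2 x &
   forall u, UV.1 u -> UV.2 (T i u) -> T i u = u].
  have [e|e] := pselect (T i x = x).
    by exists (setT, setT); split=> //=; try exact: openT; move=> u _ _; exact: T_free e u.
  have [UV [oU oV Ux Vx UVF]] := open_separation hY e.
  by exists UV; split=> // u /UVF; move=> /[apply].
have [UV UVP] := choice h.
exists [set u | forall i, ((UV i).1 `&` (UV i).2) u]; split.
- by apply: open_forall => i; have [? ? _ _ _] := UVP i; exact: openI.
- by move=> i; have [] := UVP i.
move=> u u' Uu Uu' /glue_piP/glue_T[i e].
have [_ _ _ _ h'] := UVP i; rewrite e h'//; first by case: (Uu i).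
by rewrite -e; case: (Uu' i).
Qed.

Lemma quotient_charted : hausdorff_space Y -> charted (R := R) n D ->
  charted (R := R) n [set w | exists2 x, D x.1 & pi x = w].
Proof.
move=> hY cD w; have [[y g] <-] := glue_pi_surj w.
have [c [cy cDy]] := cD y.
have [U0 [oU0 U0x inj]] := glue_pi_locally_injective (y, g) hY.
have [U1 [oU1 U1y U10]] := open_slice_sub oU0 U0x.
pose U := U1 `&` chart_dom c.
have oU : open U by apply: openI => //; exact: chart_open.
have piU u u' : U u -> U u' -> pi (u, g) = pi (u', g) -> u = u'.
  by move=> [Uu _] [Uu' _] /inj-/(_ (U10 _ Uu) (U10 _ Uu'))[].
(* Inverse of the projection on the slice [U] times [g]; [y] is a dummy value outside its image. *)
pose f w := xget y [set u | U u /\ pi (u, g) = w].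
have fK u : U u -> f (pi (u, g)) = u.
  move=> Uu; have [Uf e] : [set u' | U u' /\ pi (u', g) = pi (u, g)] (f (pi (u, g))).
    by apply: xgetPex; exists u.
  exact: piU.
have oA : open (pi @` (U `*` [set g])) by apply/glue_pi_open/open_slice.
have hf : homeomorphism (pi @` (U `*` [set g])) U f.
  apply: (@homeomorphism_can _ _ _ _ _ (fun u => pi (u, g))).
  - by move=> _ [[u _] [/= Uu ->] <-]; rewrite fK.
  - by move=> u Uu; exists (u, g).
  - by move=> _ [[u _] [/= Uu ->] <-]; rewrite fK.
  - exact: fK.
  - apply/within_openP => _ O [[u _] [/= Uu ->] <-] oO; rewrite fK// => Ou.
    exists (pi @` ((O `&` U) `*` [set g])); split.
    + by apply/glue_pi_open/open_slice; exact: openI.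
    + by exists (u, g).
    + by move=> _ [[u' _] [/= [Ou' Uu'] ->] <-] _; rewrite fK.
  - apply: continuous_subspaceT => u.
    apply: (@continuous_comp Y X W (fun u => (u, g : discrete_topology gT)) pi u); last exact: glue_pi_continuous.
    by apply: continuous_pair; [exact: cvg_id|exact: cst_continuous].
have [c' [dc' mc']] := chart_transport oA oU (@subIsetr _ _ _) hf.
exists c'; rewrite dc' mc'; split; first by exists (y, g).
move=> _ [[u _] [/= Uu ->] <-] /=; rewrite fK// cDy; last by case: Uu.
by split=> [Du|/quotient_boundary//]; exists (u, g).
Qed.

Lemma quotient_second_countable :
  second_countable (T := Y) -> second_countable (T := W).
Proof.
move=> [B cB [oB bB]].
exists ((fun Ug => pi @` (Ug.1 `*` [set Ug.2])) @` (B `*` [set: discrete_topology gT])).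
  apply: (sub_countable (card_image_le _ _)).
  apply: countableX => //.
  by apply: finite_set_countable; exact: (@finite_finset gT).
split; first by move=> _ [[U g] [/= /oB oU _] <-]; apply/glue_pi_open/open_slice.
move=> w; have [[y g] <-] := glue_pi_surj w => O; rewrite nbhsE => -[O' [oO' O'x] OO'].
have oO'' : open (pi @^-1` O') by [].
have [U [oU Uy UO]] := open_slice_sub oO'' O'x.
have [V [BV Vy] VU] : filter_from [set V | B V /\ V y] id U.
  by apply: bB; exact: open_nbhs_nbhs.
exists (pi @` (V `*` [set g])).
  by split; [exists (V, g)|exists (y, g)].
by move=> _ [[u _] [/= Vu ->] <-]; apply/OO'/UO/VU.
Qed.

Lemma quotient_compact : compact [set: Y] -> compact [set: W].
Proof.
move=> cY; have -> : [set: W] = pi @` setT.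
  by rewrite eqEsubset; split=> // w _; have [x <-] := glue_pi_surj w; exists x.
apply: continuous_compact.
  by apply: continuous_subspaceT; exact: glue_pi_continuous.
rewrite -setXTT; apply: compact_setX => //.
by apply: finite_compact; exact: (@finite_finset gT).
Qed.
End FreeQuotient.

(** * A criterion for extendability *)

Section Extension.
Context {R : realType} {gT : finGroupType} {Q : topologicalType}.
Variable to : {action gT &-> Q}.
Context {Y : topologicalType}.
Local Notation X := (Y * discrete_topology gT)%type.
Variables (D : set Y) (r : X -> X -> Prop) (I : finType) (T : I -> X -> X).
Hypothesis Y_hausdorff : hausdorff_space Y.
Hypothesis Y_countable : second_countable (T := Y).
Hypothesis Y_compact : compact [set: Y].
Hypothesis Y_charted : charted (R := R) 2 D.
Hypothesis T_cont : forall i, continuous (T i).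
Hypothesis glue_T : forall x y, glue_eq r x y <-> exists i, y = T i x.
Hypothesis T_free : forall i x, T i x = x -> forall y, T i y = y.
Hypothesis T_D : forall i x, D x.1 -> D (T i x).1.

(** The maps [T i] will multiply the group coordinate on the left, so they commute with these
    translations, which therefore descend to the quotient. *)
Definition right_translate (g : gT) (x : X) : X := (x.1, (x.2 * g)%g).

Hypothesis T_translate : forall i x g,
  T i (right_translate g x) = right_translate g (T i x).

Variable F : X -> Q.
Let DX : set X := [set x | D x.1].
Hypothesis F_cont : {within DX, continuous F}.
Hypothesis F_translate : forall x g, DX x -> F (right_translate g x) = to (F x) g.
Hypothesis F_surj : forall q, exists2 x, DX x & F x = q.
Hypothesis F_inj : forall x x', DX x -> DX x' ->
  F x = F x' <-> glue_eq r x x'.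
(** [F] on the boundary part is a quotient map; this gives the continuity of the embedding of [Q]
    into [W]. *)
Hypothesis F_quotient : forall O : set Q,
  (forall x, DX x -> O (F x) ->
     exists U, [/\ open U, U x & forall x', U x' -> DX x' -> O (F x')]) -> open O.

Local Notation W := (glue r).
Local Notation pi := (glue_pi r).

Definition quotient_translate (w : W) (g : gT) : W :=
  pi (right_translate g (repr w)).

Lemma quotient_translateE x g :
  quotient_translate (pi x) g = pi (right_translate g x).
Proof.
have /glue_piP/glue_T[i e] : pi (repr (pi x)) = pi x by exact: reprK.
apply/glue_piP/glue_T; exists i.
by rewrite T_translate; congr right_translate.
Qed.

Lemma quotient_translate_is_action : is_action [set: gT]%SET quotient_translate.
Proof.
split=> [g v w|w g h _ _].
  have [x <-] := glue_pi_surj v; have [y <-] := glue_pi_surj w.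
  rewrite !quotient_translateE => /glue_piP/glue_T[i e].
  apply/glue_piP/glue_T; exists i.
  have := congr1 (right_translate g^-1%g) e.
  rewrite -T_translate /right_translate /= !mulgK.
  by case: x {e} => x1 x2; case: y => y1 y2.
have [x <-] := glue_pi_surj w; rewrite !quotient_translateE.
by rewrite /right_translate /= mulgA.
Qed.

Lemma extendable_free_quotient : extendable R to.
Proof.
have [A mA bA] := @charted_manifold R 2 W _
  (quotient_hausdorff T_cont glue_T Y_hausdorff)
  (quotient_second_countable T_cont glue_T Y_countable)
  (quotient_charted T_cont glue_T T_free T_D Y_hausdorff Y_charted).
(* [s] is a mere set-theoretic section of [F]. Since the fibres of [F] are classes of [r], the
   composite [pi \o s] depends on no choice, and its inverse is [F] applied to any
   representative. *)
have [s sP] := choice (fun q => iffLR (exists2P _ _) (F_surj q)).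
have sD q : DX (s q) by case: (sP q).
have sK q : F (s q) = q by case: (sP q).
have pis x : DX x -> pi (s (F x)) = pi x.
  by move=> Dx; apply/glue_piP/F_inj.
exists W, A, (Action quotient_translate_is_action), (pi \o s); split=> //.
- exact: quotient_compact.
- move=> g w; apply/cvg_openP => /= O oO; move: O oO; have [x <-] := glue_pi_surj w => O oO.
  rewrite quotient_translateE => Ox.
  have oO' : open (pi @^-1` O) by [].
  case: x Ox => y h Ox; have [U [oU Uy UO]] := open_slice_sub oO' Ox.
  exists (pi @` (U `*` [set h])); split.
  + exact/(glue_pi_open T_cont glue_T)/open_slice.
  + by exists (y, h).
  + by move=> _ [[u _] [/= Uu ->] <-]; rewrite quotient_translateE; exact: UO.
- rewrite bA.
  have Fr x : DX x -> F (repr (pi x)) = F x.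
    move=> Dx; have e : pi x = pi (repr (pi x)) by rewrite [RHS]reprK.
    have Dr : DX (repr (pi x)).
      by apply/(quotient_boundary glue_T T_D); exists x.
    by apply/esym/F_inj => //; exact/glue_piP.
  apply: (@homeomorphism_can Q W _ _ (pi \o s) (fun w : W => F (repr w))).
  + by move=> q _; exists (s q) => //; exact: sD.
  + by move=> w _.
  + by move=> q _ /=; rewrite Fr.
  + by move=> _ [x Dx <-] /=; rewrite Fr// pis.
  + apply: continuous_subspaceT; apply/continuousP => O oO.
    apply: F_quotient => x Dx /=; rewrite pis// => Ox.
    exists (pi @^-1` O); split=> // x' Ox' Dx' /=.
    by rewrite /preimage/= pis.
  + move/within_openP: F_cont => Fc.
    apply/within_openP => _ O [x Dx <-] oO /=; rewrite Fr// => Ox.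
    have [U [oU Ux UO]] := Fc x O Dx oO Ox.
    exists (pi @` U); split; [exact: (glue_pi_open T_cont glue_T)|by exists x|].
    move=> _ [u Uu <-] /(quotient_boundary glue_T T_D) Du /=; rewrite Fr//.
    exact: UO.
- move=> q g /=.
  rewrite quotient_translateE.
  by rewrite -[in LHS](sK q) -F_translate// pis//; exact: (sD q).
Qed.
End Extension.

(** * Lifting maps of the plane to principal bundles *)

Lemma within_continuous_paste (R : realType) (S T : topologicalType) (A : set S)
    (f g : S -> T) (phi : S -> R) :
  {within A, continuous f} -> {within A, continuous g} -> continuous phi ->
  (forall v, A v -> phi v = 0 -> f v = g v) ->
  {within A, continuous (fun v => if phi v <= 0 then f v else g v)}.
Proof.
move=> /within_openP fc /within_openP gc pc fg; apply/within_openP => v O Av oO.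
have near (k : S -> T) : (O (k v) -> exists U, [/\ open U, U v &
    forall y, U y -> A y -> O (k y)]) -> exists U, [/\ open U, U v &
    O (k v) -> forall u, U u -> A u -> O (k u)].
  move=> kc; have [/kc[U [oU Uv UO]]|nOk] := pselect (O (k v)); first by exists U.
  by exists setT; split=> //; exact: openT.
have [U [oU Uv fO]] := near f (fc v O Av oO).
have [U' [oU' U'v gO]] := near g (gc v O Av oO).
have [v_lt0|v_gt0|v0] := ltgtP (phi v) 0 => Ov.
- exists (U `&` phi @^-1` [set x | x < 0]); split=> //.
  + by apply: openI => //; move/continuousP: pc; apply; exact: open_lt.
  + by move=> u [Uu /= /ltW ->] Au; exact: fO.
- exists (U' `&` phi @^-1` [set x | 0 < x]); split=> //.
  + by apply: openI => //; move/continuousP: pc; apply; exact: open_gt.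
  + by move=> u [Uu /=]; rewrite ltNge => /negbTE -> Au; exact: gO.
- exists (U `&` U'); split=> //; first exact: openI.
  move=> u [Uu U'u] Au; case: ifP => _; first exact: fO.
  by apply: gO; rewrite -?fg.
Qed.

Lemma continuous_paste (R : realType) (S T : topologicalType) (f g : S -> T)
    (phi : S -> R) :
  continuous f -> continuous g -> continuous phi ->
  (forall v, phi v = 0 -> f v = g v) ->
  continuous (fun v => if phi v <= 0 then f v else g v).
Proof.
move=> fc gc pc fg; apply/continuous_subspace_setT.
by apply: within_continuous_paste => //; [exact: continuous_subspaceT
  |exact: continuous_subspaceT|move=> v _; exact: fg].
Qed.

(** Subdivision into small intervals, with a supremum in place of a Lebesgue number. *)
Lemma interval_induction (R : realType) (P : R -> R -> Prop) (lo hi : R) :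
  lo <= hi ->
  (forall a b c, a <= b -> b <= c -> P a b -> P b c -> P a c) ->
  (forall x, exists2 e : R, 0 < e &
     forall a b : R, x - e < a -> a <= b -> b < x + e -> P a b) ->
  P lo hi.
Proof.
move=> lohi Ptrans Ploc.
pose A := [set t | lo <= t <= hi /\ P lo t].
have Alo : A lo.
  split; first by rewrite lexx.
  have [e e0 h] := Ploc lo; apply: h => //; lra.
have hsA : has_sup A by split; [exists lo|exists hi => t [/andP[]]].
have [e e0 he] := Ploc (sup A).
have [t [/andP[lt th] Pt] st] := sup_adherent e0 hsA.
have ts : t <= sup A by apply: sup_upper_bound => //; split=> //; apply/andP.
(* [b] exceeds [sup A] by [e / 2] unless it is capped at [hi]. As it turns out to lie in [A], the
   cap is reached and [P lo hi] holds. *)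
pose b := Num.min hi (sup A + e / 2).
have tb : t <= b by rewrite /b le_min; apply/andP; split => //; lra.
have Ab : A b.
  split.
    apply/andP; split; first exact: le_trans tb.
    by rewrite /b ge_min lexx.
  apply: (Ptrans _ _ _ lt tb Pt); apply: he => //.
  by rewrite /b gt_min; apply/orP; right; lra.
have bs : b <= sup A by exact: sup_upper_bound.
case: Ab => _; rewrite /b; case: (leP hi (sup A + e / 2)) => // h.
by exfalso; move: bs; rewrite /b (min_r (ltW h)); lra.
Qed.

Lemma total_actM (gT : finGroupType) (Q : Type) (to : {action gT &-> Q}) q g h :
  to q (g * h)%g = to (to q g) h.
Proof. by case: to => f [_ fM] /=; apply: fM; rewrite finset.in_setT. Qed.

Lemma total_act1 (gT : finGroupType) (Q : Type) (to : {action gT &-> Q}) q :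
  to q 1%g = q.
Proof.
by case: to => f [fI fM] /=; apply: (fI 1%g); rewrite -fM ?finset.in_setT// mulg1.
Qed.

Section PrincipalBundle.
Context {gT : finGroupType} {Q M : topologicalType}.
Variables (to : {action gT &-> Q}) (p : Q -> M).
Hypothesis pb : principal_bundle to p.

Lemma bundle_action_continuous g : continuous (to^~ g).
Proof. by case: pb => h _ _ _; exact: h. Qed.

Lemma bundle_proj_continuous : continuous p.
Proof. by case: pb. Qed.

Lemma bundle_proj_act q g : p (to q g) = p q.
Proof. by case: pb. Qed.

(** A trivialisation read as a section [s], its inverse on the slice of 1, and a locally constant
    coordinate [k]. Later arguments use these two maps only. *)
Lemma bundle_trivial m : exists (U : set M) (s : M -> Q) (k : Q -> gT),
  [/\ open U, U m, {within U, continuous s},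
      forall u, U u -> p (s u) = u &
  [/\ forall q, U (p q) -> to (s (p q)) (k q) = q,
      forall q g, U (p q) -> k (to q g) = (k q * g)%g &
      forall q, U (p q) -> exists V, [/\ open V, V q &
        forall q', V q' -> U (p q') -> k q' = k q]]].
Proof.
case: pb => tc pc pto /(_ m)[U [oU Um] [phi [hphi phi1 phi2]]].
have [psi [psiU phiK psiK psic]] := homeomorphism_inv hphi.
have [[phiU _ _] phic _] := hphi.
have phiE q : U (p q) -> phi q = (p q, (phi q).2).
  by move=> Uq; rewrite [LHS]surjective_pairing phi1//; exact/mem_set.
have sU u : U u -> (U `*` [set: discrete_topology gT]) (u, 1%g) by [].
have ps u : U u -> p (psi (u, 1%g)) = u.
  by move=> Uu; rewrite -phi1 ?psiK//; exact/mem_set/psiU.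
exists U, (fun u => psi (u, 1%g)), (fun q => (phi q).2); split=> //; last split.
- apply: (@within_comp _ _ _ U (U `*` [set: discrete_topology gT])
     (fun u => (u, 1%g : discrete_topology gT)) psi) => //.
  apply: continuous_subspaceT => u.
  by apply: continuous_pair; [exact: cvg_id|exact: cst_continuous].
- move=> q Uq; set q' := to _ _.
  have Uq' : U (p q') by rewrite pto ps.
  rewrite -[RHS]phiK// -[LHS]phiK//; congr psi.
  rewrite phiE// [RHS]phiE// pto ps//; congr pair.
  by rewrite phi2 ?inE ?psiK//= ?mul1g// /preimage/= ps.
- by move=> q g Uq; rewrite phi2 ?inE.
- move=> q Uq; move/within_openP: phic.
  have oS : open (setT `*` [set (phi q).2] : set (M * discrete_topology gT)).
    by apply: open_slice; exact: openT.
  move=> /(_ q (setT `*` [set (phi q).2]) Uq oS)[//|V [oV Vq h]].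
  by exists V; split=> // q' Vq' Uq'; case: (h q' Vq' Uq').
Qed.

Lemma bundle_free q g h : to q g = to q h -> g = h.
Proof.
have [U [s [k [_ Uq _ _ [_ kM _]]]]] := bundle_trivial (p q).
by move=> /(congr1 k); rewrite !kM// => /mulgI.
Qed.

Lemma bundle_transitive q q' : p q = p q' -> exists g, q' = to q g.
Proof.
have [U [s [k [_ Uq _ _ [kE kM _]]]]] := bundle_trivial (p q).
move=> e; exists ((k q)^-1 * k q')%g.
transitivity (to (to (s (p q)) (k q)) ((k q)^-1 * k q')%g); last by rewrite kE.
by rewrite -total_actM mulKVg e kE// -e.
Qed.

Lemma bundle_proj_surj m : exists q, p q = m.
Proof.
have [U [s [k [_ Um _ sU _]]]] := bundle_trivial m.
by exists (s m); exact: sU.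
Qed.

Lemma lift_locally_constant (S : topologicalType) (s1 s2 : S -> Q) v g :
  continuous s1 -> continuous s2 -> (forall u, p (s1 u) = p (s2 u)) ->
  s2 v = to (s1 v) g ->
  exists U, [/\ open U, U v & forall u, U u -> s2 u = to (s1 u) g].
Proof.
move=> c1 c2 e ev.
have [U [s [k [oU Uq _ _ [kE kM kc]]]]] := bundle_trivial (p (s1 v)).
have [V1 [oV1 V1v k1]] := kc _ Uq.
have [V2 [oV2 V2v k2]] : exists V, [/\ open V, V (s2 v) &
    forall q', V q' -> U (p q') -> k q' = k (s2 v)] by apply: kc; rewrite -e.
exists (s1 @^-1` V1 `&` s2 @^-1` V2 `&` (p \o s1) @^-1` U); split.
- apply: openI; first apply: openI.
  + by move/continuousP: c1; exact.
  + by move/continuousP: c2; exact.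
  + have /continuousP h : continuous (p \o s1).
      by move=> u; apply: continuous_comp; [exact: c1|exact: bundle_proj_continuous].
    exact: h.
- by [].
move=> u [[/= V1u V2u] Uu].
have [g' e'] := bundle_transitive (e u); rewrite e'; congr (to _ _).
have := k2 _ V2u; rewrite -e => /(_ Uu); rewrite e' ev !kM// k1//.
by move=> /mulgI.
Qed.

(** The points where the lifts differ by [g] form an open set by [lift_locally_constant]. So do the
    others, since near each of them the difference is another constant. Connectedness of the line
    concludes. *)
Lemma lift_unique (R : realType) (s1 s2 : R -> Q) x g :
  continuous s1 -> continuous s2 -> (forall u, p (s1 u) = p (s2 u)) ->
  s2 x = to (s1 x) g -> forall y, s2 y = to (s1 y) g.
Proof.
move=> c1 c2 e ex y.
pose A := [set y | s2 y = to (s1 y) g].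
have oA : open A.
  apply/openP => z Az; have [U [oU Uz UA]] := lift_locally_constant c1 c2 e Az.
  by exists U.
have cA : closed A.
  rewrite -[A]setCK; apply: open_closedC; apply/openP => z nAz.
  have [g' ez] := bundle_transitive (e z).
  have [U [oU Uz UA]] := lift_locally_constant c1 c2 e ez.
  exists U; split=> // u /UA eu Au; apply: nAz.
  by rewrite /A/= ez; congr (to _ _); move: Au; rewrite /A/= eu => /bundle_free.
suff /seteqP[_] : A = setT by apply.
have /connected_intervalP : is_interval [set: R] by [].
by apply; [exists x|exists A; rewrite ?setTI|exists A; rewrite ?setTI].
Qed.

Lemma lift_unique_from (R : realType) (s1 s2 : R -> Q) x y :
  continuous s1 -> continuous s2 -> (forall u, p (s1 u) = p (s2 u)) ->
  s1 x = s2 x -> s1 y = s2 y.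
Proof.
move=> c1 c2 e ex; rewrite -[LHS](total_act1 to).
by apply/esym/(@lift_unique _ s1 s2 x) => //; rewrite total_act1.
Qed.

Lemma lift_const (R : realType) (s1 s2 : R -> Q) :
  continuous s1 -> continuous s2 -> (forall u, p (s1 u) = p (s2 u)) ->
  exists g, forall y, s2 y = to (s1 y) g.
Proof.
move=> c1 c2 e; have [g eg] := bundle_transitive (e 0).
by exists g; exact: lift_unique eg.
Qed.

Lemma lift_act_continuous (S : topologicalType) (s : S -> Q) g :
  continuous s -> continuous (fun v => to (s v) g).
Proof.
move=> sc v; apply: (@continuous_comp _ _ _ s (to^~ g)); first exact: sc.
exact: bundle_action_continuous.
Qed.

(** * Lifts over rectangles and over the plane *)

Section Rectangles.
Variable R : realType.
Implicit Types (E : R * R -> M) (a b c d e : R).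

Definition clamp a b x : R := Num.max a (Num.min x b).

Lemma clamp_continuous a b : continuous (clamp a b).
Proof.
move=> x; apply: (@continuous_max _ _ (cst a) (fun x => Num.min x b)).
  exact: cst_continuous.
by apply: continuous_min; [exact: cvg_id|exact: cst_continuous].
Qed.

Lemma clamp_id a b x : a <= x <= b -> clamp a b x = x.
Proof. by move=> /andP[ax xb]; rewrite /clamp min_l// max_r. Qed.

Lemma clamp_itv a b x : a <= b -> a <= clamp a b x <= b.
Proof.
by move=> ab; rewrite /clamp le_max lexx ge_max ab ge_min lexx orbT.
Qed.

(** Clamping turns a lift over a rectangle into a total continuous map of the plane, so that lifts
    are glued and compared without subspace topologies. *)
Definition rectangle_lift E a b c d := exists s : R * R -> Q,
  continuous s /\ forall v, p (s v) = E (clamp a b v.1, clamp c d v.2).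

Lemma rectangle_lift_swap E a b c d :
  rectangle_lift (fun v => E (v.2, v.1)) c d a b -> rectangle_lift E a b c d.
Proof.
move=> [s [sc sE]]; exists (fun v => s (v.2, v.1)); split=> [v|v].
  apply: (@continuous_comp _ _ _ (fun v => (v.2, v.1)) s); last exact: sc.
  by apply: continuous_pair; [exact: cvg_snd|exact: cvg_fst].
by rewrite sE.
Qed.

(** On the common side the two lifts differ by a constant; the second one is translated by it before
    pasting. *)
Lemma rectangle_lift_glue E a b e c d : a <= b -> b <= e ->
  rectangle_lift E a b c d -> rectangle_lift E b e c d ->
  rectangle_lift E a e c d.
Proof.
move=> ab be [s1 [c1 E1]] [s2 [c2 E2]].
have cb (s : R * R -> Q) : continuous s -> continuous (fun y => s (b, y)).
  move=> sc y; apply: (@continuous_comp _ _ _ (fun y => (b, y)) s); last exact: sc.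
  by apply: continuous_pair; [exact: cst_continuous|exact: cvg_id].
have [|g eg] := lift_const (cb _ c2) (cb _ c1).
  by move=> y; rewrite E1 E2 /= (@clamp_id a b) ?(@clamp_id b e) ?lexx ?ab ?be.
exists (fun v => if v.1 - b <= 0 then s1 v else to (s2 v) g); split.
  apply: continuous_paste => //; first exact: lift_act_continuous.
    by move=> v; apply: continuousB; [exact: cvg_fst|exact: cst_continuous].
  by move=> [x y] /= /eqP; rewrite subr_eq0 => /eqP ->; exact: eg.
move=> v; case: ifPn; rewrite subr_le0 => vb.
  rewrite E1; congr (E (_, _)); congr Num.max.
  by rewrite !min_l// (le_trans vb be).
rewrite bundle_proj_act E2; congr (E (_, _)).
rewrite -ltNge in vb; rewrite /clamp.
have vm : b <= Num.min v.1 e by rewrite le_min ltW.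
by rewrite !max_r// (le_trans ab).
Qed.

Lemma rectangle_lift_local E x y : continuous E ->
  exists2 e : R, 0 < e & forall a b c d,
    x - e < a -> a <= b -> b < x + e -> y - e < c -> c <= d -> d < y + e ->
    rectangle_lift E a b c d.
Proof.
move=> Ec; have [U [s [k [oU Uxy sc sU _]]]] := bundle_trivial (E (x, y)).
have : nbhs (x, y) (E @^-1` U) by apply: Ec; exact: open_nbhs_nbhs.
move=> /nbhs_ballP[e /= e0 he]; exists e => // a b c d xa ab bx yc cd dy.
have hU v : U (E (clamp a b v.1, clamp c d v.2)).
  apply: he; split => /=; rewrite /ball/= ltr_norml.
    have /andP[h1 h2] := clamp_itv v.1 ab; apply/andP; split; lra.
  have /andP[h1 h2] := clamp_itv v.2 cd; apply/andP; split; lra.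
exists (fun v => s (E (clamp a b v.1, clamp c d v.2))); split; last first.
  by move=> v; rewrite sU.
apply/continuous_subspace_setT.
apply: (@within_comp _ _ _ setT U (fun v => E (clamp a b v.1, clamp c d v.2)) s) => //.
apply: continuous_subspaceT => v.
apply: (@continuous_comp _ _ _ (fun v => (clamp a b v.1, clamp c d v.2)) E).
  apply: continuous_pair.
    by apply: (@continuous_comp _ _ _ fst (clamp a b)); [exact: cvg_fst|exact: clamp_continuous].
  by apply: (@continuous_comp _ _ _ snd (clamp c d)); [exact: cvg_snd|exact: clamp_continuous].
exact: Ec.
Qed.

Lemma rectangle_lift_exists E a b c d : continuous E ->
  a <= b -> c <= d -> rectangle_lift E a b c d.
Proof.
move=> Ec ab cd.
apply: (@interval_induction _ (fun a b => rectangle_lift E a b c d)) => //.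
  by move=> a' b' e' ? ?; exact: rectangle_lift_glue.
move=> x.
(* For a fixed abscissa [x], a second induction in the vertical direction lifts over a thin strip.
   The half-width [e] of the strip belongs to the property, and shrinks to a minimum when two pieces
   are glued. *)
apply: (@interval_induction _ (fun c d => exists2 e : R, 0 < e & forall a b,
   x - e < a -> a <= b -> b < x + e -> rectangle_lift E a b c d)) => //.
  move=> c1 c2 c3 c12 c23 [e1 e10 h1] [e2 e20 h2].
  exists (Num.min e1 e2); first by rewrite lt_min e10.
  move=> a' b' xa a'b' bx; apply: rectangle_lift_swap.
  have m1 : Num.min e1 e2 <= e1 by rewrite ge_min lexx.
  have m2 : Num.min e1 e2 <= e2 by rewrite ge_min lexx orbT.
  apply: (@rectangle_lift_glue _ c1 c2 c3) => //; apply: rectangle_lift_swap.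
    by rewrite (_ : (fun v => _) = E); [apply: h1 => //; lra|apply/funext => -[]].
  by rewrite (_ : (fun v => _) = E); [apply: h2 => //; lra|apply/funext => -[]].
move=> y; have [e e0 h] := rectangle_lift_local x y Ec.
by exists e => // c' d' ? ? ?; exists e => // a' b' ? ? ?; exact: h.
Qed.

(** Lifts over the squares of half-side [N], all normalised to [q0] at the origin, agree where they
    overlap, by uniqueness along the segment from the origin. The value at [v] is read on any square
    containing [v]. *)
Lemma plane_lift E : continuous E ->
  exists s : R * R -> Q, continuous s /\ forall v, p (s v) = E v.
Proof.
move=> Ec; have [q0 q0E] := bundle_proj_surj (E (0, 0)).
have hN (N : nat) : exists s : R * R -> Q, [/\ continuous s,
   forall v, p (s v) = E (clamp (- N%:R) N%:R v.1, clamp (- N%:R) N%:R v.2) &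
   s (0, 0) = q0].
  have NN : - N%:R <= N%:R :> R by rewrite -subr_ge0 opprK addr_ge0.
  have [s [sc sE]] := rectangle_lift_exists Ec NN NN.
  have [|g eg] := @bundle_transitive (s (0, 0)) q0.
    by rewrite sE q0E !clamp_id//= oppr_le0 ler0n.
  exists (fun v => to (s v) g); split=> //; first exact: lift_act_continuous.
  by move=> v; rewrite bundle_proj_act.
have [s sP] := choice hN.
have agree N N' (v : R * R) : `|v.1| <= N%:R -> `|v.2| <= N%:R ->
    `|v.1| <= N'%:R -> `|v.2| <= N'%:R -> s N v = s N' v.
  move=> h1 h2 h1' h2'.
  (* The segment from the origin to [v]. Clamping keeps the path in the squares for every real
     parameter, as uniqueness of lifts is stated on the whole line. *)
  pose path t := (clamp 0 1 t * v.1, clamp 0 1 t * v.2).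
  have pathc : continuous path.
    move=> t; apply: (@continuous_pair _ _ _ (fun t => clamp 0 1 t * v.1)
      (fun t => clamp 0 1 t * v.2)); apply: continuousM;
      by [exact: clamp_continuous|exact: cst_continuous].
  have path_in K (x t : R) : `|x| <= K%:R -> - K%:R <= clamp 0 1 t * x <= K%:R.
    move=> xK; rewrite -ler_norml normrM.
    have /andP[t0 t1] : 0 <= clamp 0 1 t <= 1 by apply: clamp_itv.
    by rewrite (ger0_norm t0) -[leRHS]mul1r; apply: ler_pM.
  have path1 : path 1 = v.
    by rewrite /path clamp_id ?ler01 ?lexx// !mul1r -surjective_pairing.
  have path0 : path 0 = (0, 0) by rewrite /path clamp_id ?ler01 ?lexx// !mul0r.
  rewrite -path1; apply: (@lift_unique_from R (s N \o path) (s N' \o path) 0 1).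
  - move=> t; apply: continuous_comp; first exact: pathc.
    by have [h _ _] := sP N; exact: h.
  - move=> t; apply: continuous_comp; first exact: pathc.
    by have [h _ _] := sP N'; exact: h.
  - move=> t /=; have [_ -> _] := sP N; have [_ -> _] := sP N'.
    by rewrite !clamp_id//; exact: path_in.
  - by rewrite /= path0; have [_ _ ->] := sP N; have [_ _ ->] := sP N'.
(* The successor makes the bound strict, so that the same square serves in a neighbourhood of
   [v]. *)
pose bd (v : R * R) := (Num.trunc (`|v.1| + `|v.2|)).+1.
have bdP v : `|v.1| < (bd v)%:R /\ `|v.2| < (bd v)%:R.
  have h : `|v.1| + `|v.2| < (bd v)%:R by apply: truncnS_gt; rewrite addr_ge0.
  by have := normr_ge0 v.1; have := normr_ge0 v.2; split; lra.
exists (fun v => s (bd v) v); split; last first.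
  move=> v; have [_ -> _] := sP (bd v); have [b1 b2] := bdP v.
  by rewrite !clamp_id -?ler_norml ?ltW// -surjective_pairing.
move=> v; apply/cvg_openP => O oO Ov.
have [sc _ _] := sP (bd v).
have /cvg_openP/(_ O oO Ov)[U [oU Uv UO]] := sc v.
exists (U `&` [set u | `|u.1| < (bd v)%:R /\ `|u.2| < (bd v)%:R]); split.
- apply: openI => //; apply: openI.
    apply: (@open_comp _ _ (fun u : R * R => `|u.1|) [set x | x < (bd v)%:R]); last exact: open_lt.
    by move=> u _; apply: (@continuous_comp _ _ _ fst); [exact: cvg_fst|exact: norm_continuous].
  apply: (@open_comp _ _ (fun u : R * R => `|u.2|) [set x | x < (bd v)%:R]); last exact: open_lt.
  by move=> u _; apply: (@continuous_comp _ _ _ snd); [exact: cvg_snd|exact: norm_continuous].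
- by split=> //; exact: bdP.
- move=> u [Uu [/ltW b1 /ltW b2]]; have [/ltW b1' /ltW b2'] := bdP u.
  by rewrite (@agree _ (bd v))//; exact: UO.
Qed.

End Rectangles.
End PrincipalBundle.

(** * Gluing the sides of a square *)

(** Over a trivialising open set, a sheet of [Q] is a copy of the base, and the lift [s] meets this
    sheet after translation by a locally constant element. Openness in [Q] thus reduces to openness
    in [M], which [E] detects. *)
Lemma lift_quotient_map (gT : finGroupType) (Q M S : topologicalType)
    (to : {action gT &-> Q}) (p : Q -> M) (E : S -> M) (s : S -> Q) :
  principal_bundle to p ->
  (forall U : set M, open (E @^-1` U) -> open U) ->
  continuous s -> (forall v, p (s v) = E v) ->
  forall O : set Q, (forall g, open [set v | O (to (s v) g)]) -> open O.
Proof.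
move=> pb qE sc sE O hO; apply/openP => q Oq.
have [U [sg [k [oU Uq _ sgU [kE kM kc]]]]] := bundle_trivial pb (p q).
have [V [oV Vq Vk]] := kc _ Uq.
(* The image in the base of the part of [O] that lies on the sheet of [q]. *)
pose N := U `&` [set m | O (to (sg m) (k q))].
have oN : open N.
  apply: qE; apply/openP => v [Uv Ov].
  have Upv : U (p (s v)) by rewrite sE.
  have [V' [oV' V'v V'k]] := kc _ Upv.
  (* The element moving [s v] to the sheet of [q]; it also does so for [s v'] near [v], [k] being
     locally constant. *)
  pose g0 := ((k (s v))^-1 * k q)%g.
  have eO v' : V' (s v') -> U (E v') -> to (s v') g0 = to (sg (E v')) (k q).
    move=> Vv' Uv'; rewrite -sE in Uv' *.
    rewrite -[in LHS](kE (s v'))// -total_actM V'k// /g0 mulKVg.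
    by [].
  have cU : open (E @^-1` U).
    have -> : E = p \o s by apply/funext => u /=; rewrite sE.
    have /continuousP h : continuous (p \o s); last exact: h.
    move=> u; apply: continuous_comp; first exact: sc.
    exact: (bundle_proj_continuous pb).
  exists ([set v | O (to (s v) g0)] `&` (s @^-1` V' `&` E @^-1` U)); split.
  - apply: openI => //; apply: openI => //.
    by move/continuousP: sc; exact.
  - by split=> //=; rewrite eO.
  - by move=> v' [/= Ov' [V'v' Uv']]; split=> //=; rewrite -eO.
exists (V `&` p @^-1` N); split.
- by apply: openI => //; move/continuousP: (bundle_proj_continuous pb); exact.
- by split=> //; split=> //=; rewrite kE.
- by move=> q' [Vq' [Uq' /=]]; rewrite -(Vk q')// kE.
Qed.

Section UnitSquare.
Context {R : realType}.

Lemma uclamp_subproof (x : R) : clamp 0 1 x \in (`[0 : R, 1]%classic : set R).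
Proof. by rewrite mem_setE in_itv /=; exact: clamp_itv. Qed.

Definition uclamp (x : R) : unit_interval R := SigSub (uclamp_subproof x).

Lemma val_uclamp x : \val (uclamp x) = clamp 0 1 x.
Proof. by []. Qed.

Lemma unit_interval_itv (t : unit_interval R) : 0 <= \val t <= 1.
Proof. by case: t => t /=; rewrite mem_setE in_itv. Qed.

Lemma uclampK (t : unit_interval R) : uclamp (\val t) = t.
Proof. by apply: val_inj; rewrite val_uclamp clamp_id// unit_interval_itv. Qed.

Lemma uclamp_continuous : continuous uclamp.
Proof.
apply: continuous_comp_initial => x; exact: clamp_continuous.
Qed.

Lemma unit_val_continuous : continuous (fun t : unit_interval R => \val t : R).
Proof. exact: initial_continuous. Qed.

Variables fv fh : bool.
Local Notation r := (@square_side R fv fh).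

Definition square_pi (v : R * R) : glue r := glue_pi r (uclamp v.1, uclamp v.2).

Lemma square_pi_continuous : continuous square_pi.
Proof.
move=> v; apply: (@continuous_comp _ _ _ (fun v : R * R => (uclamp v.1, uclamp v.2)) (glue_pi r));
  last exact: glue_pi_continuous.
by apply: continuous_pair; [apply: (@continuous_comp _ _ _ fst uclamp); [exact: cvg_fst|]
 |apply: (@continuous_comp _ _ _ snd uclamp); [exact: cvg_snd|]];
  exact: uclamp_continuous.
Qed.

Lemma square_pi_val a : square_pi (\val a.1, \val a.2) = glue_pi r a.
Proof. by rewrite /square_pi !uclampK -surjective_pairing. Qed.

Lemma square_pi_quotient (U : set (glue r)) (O : set (R * R)) : open O ->
  (forall v, 0 <= v.1 <= 1 -> 0 <= v.2 <= 1 -> O v <-> U (square_pi v)) ->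
  open U.
Proof.
move=> oO OU; apply: open_glue.
have -> : glue_pi r @^-1` U = (fun a => (\val a.1, \val a.2) : R * R) @^-1` O.
  rewrite eqEsubset; split=> a /=.
    by rewrite -square_pi_val => /(OU (\val a.1, \val a.2)); apply; exact: unit_interval_itv.
  by move=> /OU; rewrite square_pi_val; apply; exact: unit_interval_itv.
have /continuousP h : continuous (fun a : unit_interval R * unit_interval R =>
   (\val a.1, \val a.2) : R * R); last exact: h.
move=> a; apply: (@continuous_pair _ _ _ (fun a : unit_interval R * unit_interval R =>
   \val a.1 : R) (fun a => \val a.2 : R)).
  by apply: (@continuous_comp _ _ _ fst (fun t : unit_interval R => \val t : R)); [exact: cvg_fst|exact: unit_val_continuous].
by apply: (@continuous_comp _ _ _ snd (fun t : unit_interval R => \val t : R)); [exact: cvg_snd|exact: unit_val_continuous].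
Qed.

Lemma clamp_le0 (x : R) : x <= 0 -> clamp 0 1 x = 0.
Proof. by move=> x0; rewrite /clamp min_l ?max_l// (le_trans x0). Qed.

Lemma clamp_ge1 (x : R) : 1 <= x -> clamp 0 1 x = 1.
Proof. by move=> x1; rewrite /clamp min_r// max_r. Qed.

Lemma clamp01_rev x : clamp 0 1 (1 - x) = 1 - clamp 0 1 x :> R.
Proof.
have [x0|x0] := leP x 0.
  by rewrite (clamp_le0 x0) clamp_ge1 ?subr0//; lra.
have [x1|x1] := leP x 1; first by rewrite !clamp_id//; apply/andP; split; lra.
by rewrite (clamp_ge1 (ltW x1)) clamp_le0 ?subrr//; lra.
Qed.

Lemma square_pi_vertical y :
  square_pi (0, y) = square_pi (1, if fv then 1 - y else y).
Proof.
apply/glue_piP/glue_eqP/rst_step; left; split=> //=.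
- by rewrite clamp_id// lexx ler01.
- by rewrite clamp_id// lexx ler01.
- by rewrite /edge /=; case: fv; rewrite //= clamp01_rev.
Qed.

Lemma square_pi_horizontal x :
  square_pi (x, 0) = square_pi (if fh then 1 - x else x, 1).
Proof.
apply/glue_piP/glue_eqP/rst_step; right; split=> //=.
- by rewrite clamp_id// lexx ler01.
- by rewrite clamp_id// lexx ler01.
- by rewrite /edge /=; case: fh; rewrite //= clamp01_rev.
Qed.

(** Induction on the generated equivalence. The side identifications are asked of [P] on whole
    lines, which spares the bounds in the induction. *)
Lemma square_pi_fiber (P : R * R -> R * R -> Prop) :
  (forall v, P v v) -> (forall v w, P v w -> P w v) ->
  (forall u v w, P u v -> P v w -> P u w) ->
  (forall y, P (0, y) (1, if fv then 1 - y else y)) ->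
  (forall x, P (x, 0) (if fh then 1 - x else x, 1)) ->
  forall v w, 0 <= v.1 <= 1 -> 0 <= v.2 <= 1 -> 0 <= w.1 <= 1 -> 0 <= w.2 <= 1 ->
  square_pi v = square_pi w -> P v w.
Proof.
move=> Prefl Psym Ptrans Pv Ph v w v1 v2 w1 w2 /glue_piP/glue_eqP.
suff h a b : clos_refl_sym_trans _ r a b ->
    P (\val a.1, \val a.2) (\val b.1, \val b.2).
  by move/h => /=; rewrite !clamp_id// -!surjective_pairing.
elim=> {a b} [a b|a|a b _|a b c _ + _]; [|by []|exact: Psym|exact: Ptrans].
move=> [[-> -> e]|[-> -> e]].
  by have := Pv (\val a.2); rewrite -e.
by have := Ph (\val a.1); rewrite -e.
Qed.

End UnitSquare.

Section Frac.
Context {R : realType}.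
Implicit Types x : R.

Definition frac x : R := x - (Num.floor x)%:~R.

Lemma frac_itv x : 0 <= frac x < 1.
Proof.
have /andP[h1 h2] := floor_itv x.
by rewrite /frac; move: h2; rewrite intrD; lra.
Qed.

Lemma frac_id x : 0 <= x < 1 -> frac x = x.
Proof.
by move=> h; rewrite /frac (@floor_def _ x 0) ?add0r ?subr0.
Qed.

Lemma frac_add1 x : frac (x + 1) = frac x.
Proof.
rewrite /frac (@floor_def _ (x + 1) (Num.floor x + 1)).
  by rewrite intrD; lra.
have /andP[h1 h2] := floor_itv x.
by move: h2; rewrite !intrD; lra.
Qed.

Lemma frac_sub1 x : frac (x - 1) = frac x.
Proof. by rewrite -frac_add1 subrK. Qed.

End Frac.

(** * The plane as a covering of the torus and of the Klein bottle *)

Section Unroll.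
Context {R : realType} (flip : bool).
Local Notation sq := (@square_pi R flip false).
Local Notation sigma := ((-1) ^+ flip : R).

Lemma sigma_sq : sigma * sigma = 1.
Proof. by rewrite -expr2 sqrr_sign. Qed.

Lemma sigma_unit : sigma \is a GRing.unit.
Proof. by case: flip; rewrite ?expr1 ?unitrN1 ?unitr1. Qed.

Lemma sigma_expS (i : int) : sigma ^ (i + 1) = sigma * sigma ^ i.
Proof. by rewrite exprzDr ?sigma_unit// expr1z mulrC. Qed.

Lemma sigma_cases : sigma = 1 \/ sigma = -1.
Proof. by case: flip; [right|left]; rewrite ?expr1. Qed.

Lemma sigma_exp_cases (i : int) : sigma ^ i = 1 \/ sigma ^ i = -1.
Proof.
elim/int_rect: i => [|n IH|n IH]; first by left.
- by rewrite -addn1 PoszD sigma_expS; case: IH => ->; case: sigma_cases => ->;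
    rewrite ?mul1r ?mulr1 ?mulN1r ?opprK; auto.
- have := sigma_expS (- n.+1%:Z).
  have -> : - n.+1%:Z + 1 = - n%:Z by rewrite -addn1 PoszD opprD subrK.
  move=> e.
  have -> : sigma ^ (- n.+1%:Z) = sigma * sigma ^ (- n%:Z).
    by rewrite e mulrA sigma_sq mul1r.
  by case: IH => ->; case: sigma_cases => ->;
    rewrite ?mul1r ?mulr1 ?mulN1r ?opprK; auto.
Qed.

Lemma square_pi_straight y : ~~ flip -> sq (0, y) = sq (1, y).
Proof. by move=> fl; rewrite square_pi_vertical ifN. Qed.

Lemma square_pi_flip y : flip -> sq (0, y) = sq (1, 1 - y).
Proof. by move=> fl; rewrite square_pi_vertical ifT. Qed.

Definition plane_step (v w : R * R) : Prop :=
  w = (v.1 + 1, sigma * v.2) \/ w = (v.1, v.2 + 1).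

(** Equivalences containing the steps replace the deck group of the plane: two points are in one
    orbit when all such [P] relate them. *)
Definition step_closed (P : R * R -> R * R -> Prop) : Prop :=
  [/\ forall v, P v v, forall v w, P v w -> P w v,
      forall u v w, P u v -> P v w -> P u w &
      forall v w, plane_step v w -> P v w].

Lemma step_shift P : step_closed P -> forall (i j : int) v,
  P v (v.1 + i%:~R, sigma ^ i * v.2 + j%:~R).
Proof.
move=> [Prefl Psym Ptrans Pstep].
have horiz (i : int) v : P v (v.1 + i%:~R, sigma ^ i * v.2).
  have step (k : int) u : P (u.1 + k%:~R, sigma ^ k * u.2)
                            (u.1 + (k + 1)%:~R, sigma ^ (k + 1) * u.2).
    apply: Pstep; left => /=.
    by rewrite intrD addrA sigma_expS -mulrA.
  elim/int_rect: i => [|n IH|n IH].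
  - by rewrite addr0 mul1r -surjective_pairing.
  - by apply: Ptrans IH _; rewrite -addn1 PoszD; exact: step.
  - apply: Ptrans IH _; apply: Psym.
    have := step (- n.+1%:Z) v.
    by have -> : - n.+1%:Z + 1 = - n%:Z by rewrite -addn1 PoszD opprD subrK.
have vert (j : int) v : P v (v.1, v.2 + j%:~R).
  have step (k : int) u : P (u.1, u.2 + k%:~R) (u.1, u.2 + (k + 1)%:~R).
    by apply: Pstep; right; rewrite /= intrD addrA.
  elim/int_rect: j => [|n IH|n IH].
  - by rewrite addr0 -surjective_pairing.
  - by apply: Ptrans IH _; rewrite -addn1 PoszD; exact: step.
  - apply: Ptrans IH _; apply: Psym.
    have := step (- n.+1%:Z) v.
    by have -> : - n.+1%:Z + 1 = - n%:Z by rewrite -addn1 PoszD opprD subrK.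
by move=> i j v; apply: Ptrans (horiz i v) _; exact: (vert j (_, _)).
Qed.

(** The representative of the orbit of [v] in the fundamental domain [0, 1) x [0, 1): each
    horizontal unit step also applies [sigma] to the ordinate. *)
Definition plane_rep (v : R * R) : R * R :=
  (frac v.1, frac (sigma ^ (- Num.floor v.1) * v.2)).

Lemma plane_rep_closed P v : step_closed P -> P v (plane_rep v).
Proof.
move=> Pc.
have := step_shift Pc (- Num.floor v.1)
  (- Num.floor (sigma ^ (- Num.floor v.1) * v.2)) v.
by rewrite !intrN.
Qed.

Definition unroll (v : R * R) : glue (square_side flip false) :=
  sq (plane_rep v).

Lemma unroll_step v w : plane_step v w -> unroll v = unroll w.
Proof.
case: v => x y [|] -> /=; rewrite /unroll /plane_rep /=; congr (sq (_, _)).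
- by rewrite frac_add1.
- have -> : Num.floor (x + 1) = Num.floor x + 1.
    by apply: floor_def; have /andP[] := floor_itv x; rewrite !intrD; lra.
  have := sigma_expS (- (Num.floor x + 1)); rewrite opprD subrK => ->.
  rewrite [in RHS]mulrCA !mulrA.
  by rewrite -[RHS]/(frac _); congr frac; rewrite mulrC !mulrA; ring.
- by case: (sigma_exp_cases (- Num.floor x)) => ->;
    rewrite ?mul1r ?mulN1r ?opprD ?frac_add1 ?frac_sub1.
Qed.

Lemma unroll_closed : step_closed (fun v w => unroll v = unroll w).
Proof. by split=> // [u v w -> -> //|v w /unroll_step]. Qed.

Lemma plane_rep_itv v :
  (0 <= (plane_rep v).1 <= 1) /\ (0 <= (plane_rep v).2 <= 1).
Proof.
by rewrite /plane_rep /=; split;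
  match goal with |- is_true (0 <= frac ?x <= 1) => have /andP[] := frac_itv x end;
  move=> -> /ltW.
Qed.

Lemma unroll_fiber P v w : step_closed P -> unroll v = unroll w -> P v w.
Proof.
move=> Pc e; have [Prefl Psym Ptrans Pstep] := Pc.
apply: (Ptrans _ _ _ (plane_rep_closed v Pc)).
apply: (Ptrans _ _ _ _ (Psym _ _ (plane_rep_closed w Pc))).
have [v1 v2] := plane_rep_itv v; have [w1 w2] := plane_rep_itv w.
apply: (square_pi_fiber Prefl Psym Ptrans _ _ v1 v2 w1 w2 e) => [y|x]; last by apply: Pstep; right; rewrite /= add0r.
have [fl|fl] : ~~ flip \/ flip by case: flip; [right|left].
  by apply: Pstep; left; rewrite /= (negbTE fl) add0r mul1r.
(* In the Klein bottle, the side identification (0, y) ~ (1, 1 - y) is a horizontal step to (1, - y)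
   followed by a vertical one. *)
apply: (Ptrans _ (1, - y)); apply: Pstep.
  by left; rewrite /= fl add0r expr1 mulN1r.
by right; rewrite fl /= addrC.
Qed.

Lemma unroll_rep v : 0 <= v.1 < 1 -> 0 <= v.2 < 1 -> unroll v = sq v.
Proof.
move=> v1 v2; rewrite /unroll /plane_rep (@floor_def _ v.1 0); last by rewrite add0r.
by rewrite oppr0 expr0z mul1r !frac_id// -surjective_pairing.
Qed.

(** The fundamental domain is half-open: the upper and right sides have to be carried to the
    opposite ones by the gluing. *)
Lemma unroll_square v : 0 <= v.1 <= 1 -> 0 <= v.2 <= 1 -> unroll v = sq v.
Proof.
case: v => x y /= /andP[x0 x1] /andP[y0 y1].
have h1 x' y' : 0 <= x' < 1 -> 0 <= y' <= 1 -> unroll (x', y') = sq (x', y').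
  move=> x'01 /andP[y'0]; rewrite le_eqVlt => /predU1P[->|y'1]; last first.
    by rewrite unroll_rep//= y'0.
  rewrite -square_pi_horizontal -unroll_rep//= ?lexx ?ltr01//.
  by apply/esym/unroll_step; right; rewrite /= add0r.
move: x1; rewrite le_eqVlt => /predU1P[->|x1]; last first.
  by rewrite h1//; apply/andP.
have [fl|fl] : ~~ flip \/ flip by case: flip; [right|left].
  rewrite -square_pi_straight//.
  rewrite -h1//= ?lexx ?ltr01// ?y0//; apply/esym/unroll_step; left.
  by rewrite /= (negbTE fl) add0r mul1r.
have -> : sq (1, y) = sq (0, 1 - y) by rewrite square_pi_flip// opprB addrC subrK.
rewrite -h1//= ?lexx ?ltr01//; last by apply/andP; split; lra.
have -> : unroll (0, 1 - y) = unroll (0, - y).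
  by apply/esym/unroll_step; right; rewrite /= addrC.
by apply/esym/unroll_step; left; rewrite /= fl add0r expr1 mulN1r opprK.
Qed.

(** [plane_rep] jumps along the grid, so continuity of [unroll] is not visible on its definition.
    [e1] pastes two unit squares vertically and [e2] pastes two such columns; [e2] is continuous and
    equals [unroll] on the open square of half-side 1. Every point of the plane is brought there by
    steps. *)
Let e1 (v : R * R) := if v.2 <= 0 then sq (v.1, v.2 + 1) else sq v.
Let e2 (v : R * R) := if v.1 <= 0 then e1 (v.1 + 1, sigma * v.2) else e1 v.

Let e1_continuous : continuous e1.
Proof.
rewrite /e1; apply: (@continuous_paste R _ _ (fun v : R * R => sq (v.1, v.2 + 1)) sq (fun v => v.2)).
- move=> v; apply: (@continuous_comp _ _ _ (fun v : R * R => (v.1, v.2 + 1)) sq);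
    last exact: square_pi_continuous.
  apply: continuous_pair; first exact: cvg_fst.
  by apply: continuousD; [exact: cvg_snd|exact: cst_continuous].
- exact: square_pi_continuous.
- by move=> v; exact: cvg_snd.
- by move=> [x y] /= ->; rewrite add0r -square_pi_horizontal.
Qed.

Let e1_glue y : e1 (1, sigma * y) = e1 (0, y).
Proof.
rewrite /e1 /=; have [fl|fl] : ~~ flip \/ flip by case: flip; [right|left].
  by have -> : sigma = 1; [rewrite (negbTE fl)|rewrite mul1r !square_pi_straight].
have -> : sigma = -1 by rewrite fl expr1.
rewrite mulN1r !square_pi_flip// oppr_le0.
case: (ltgtP y 0) => [y0|y0|->].
- by rewrite opprD addrCA subrr addr0.
- by rewrite addrC.
- by rewrite oppr0 add0r subrr -square_pi_horizontal.
Qed.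

Let e2_continuous : continuous e2.
Proof.
rewrite /e2; apply: (@continuous_paste R _ _ (fun v : R * R => e1 (v.1 + 1, sigma * v.2)) e1 (fun v => v.1)).
- move=> v; apply: (@continuous_comp _ _ _ (fun v : R * R => (v.1 + 1, sigma * v.2)) e1);
    last exact: e1_continuous.
  apply: continuous_pair.
    by apply: continuousD; [exact: cvg_fst|exact: cst_continuous].
  by apply: continuousM; [exact: cst_continuous|exact: cvg_snd].
- exact: e1_continuous.
- by move=> v; exact: cvg_fst.
- by move=> [x y] /= ->; rewrite add0r e1_glue.
Qed.

Let unroll_e2 v : -1 < v.1 < 1 -> -1 < v.2 < 1 -> unroll v = e2 v.
Proof.
have h1 u : 0 <= u.1 <= 1 -> -1 < u.2 < 1 -> unroll u = e1 u.
  case: u => x y /= x01 /andP[y0 y1]; rewrite /e1 /=; case: leP => yle.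
    rewrite -unroll_square//=; last by apply/andP; split; lra.
    by apply: unroll_step; right.
  by rewrite -unroll_square//=; apply/andP; split; lra.
case: v => x y /= /andP[x0 x1] /andP[y0 y1]; rewrite /e2 /=; case: leP => xle.
  rewrite -h1/=; first by apply: unroll_step; left.
    by apply/andP; split; lra.
  by apply/andP; case: sigma_cases => ->; split; lra.
by rewrite -h1//=; apply/andP; split; lra.
Qed.

Lemma unroll_continuous : continuous unroll.
Proof.
move=> v0; set i := - Num.floor v0.1.
set j := - Num.floor (sigma ^ i * v0.2).
pose shift (v : R * R) := (v.1 + i%:~R, sigma ^ i * v.2 + j%:~R).
have shiftE v : unroll (shift v) = unroll v.
  by have /esym := step_shift unroll_closed i j v.
have shift_cont : continuous shift.
  move=> v; apply: (@continuous_pair _ _ _ (fun v : R * R => v.1 + i%:~R)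
     (fun v : R * R => sigma ^ i * v.2 + j%:~R)).
    by apply: continuousD; [exact: cvg_fst|exact: cst_continuous].
  apply: continuousD; last exact: cst_continuous.
  by apply: continuousM; [exact: cst_continuous|exact: cvg_snd].
pose V : set (R * R) := [set v | -1 < v.1 < 1 /\ -1 < v.2 < 1].
have oV : open V.
  have oI : open [set x : R | -1 < x < 1].
    have -> : [set x : R | -1 < x < 1] = `]-1, 1[%classic.
      by apply/seteqP; split=> x; rewrite /= in_itv.
    exact: interval_open.
  have -> : V = fst @^-1` [set x : R | -1 < x < 1] `&` snd @^-1` [set x : R | -1 < x < 1] by [].
  by apply: openI; apply: open_comp => //= v _; [exact: cvg_fst|exact: cvg_snd].
have Vv0 : V (shift v0).
  rewrite /V/shift/= /j /i !intrN.
  have /andP[h1 h2] := frac_itv v0.1.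
  have /andP[h3 h4] := frac_itv (sigma ^ (- Num.floor v0.1) * v0.2).
  by rewrite /frac in h1 h2 h3 h4; split; apply/andP; split; lra.
apply/cvg_openP => O oO Ov0.
have ec : {for v0, continuous (e2 \o shift)}.
  by apply: continuous_comp; [exact: shift_cont|exact: e2_continuous].
have /cvg_openP/(_ O oO)[|U [oU Uv0 UO]] := ec.
  by rewrite /= -unroll_e2 ?shiftE//; case: Vv0.
exists (U `&` shift @^-1` V); split=> //.
- by apply: openI => //; move/continuousP: shift_cont; exact.
- by move=> v [Uv [/= h1 h2]]; rewrite -shiftE unroll_e2//; exact: UO.
Qed.

Lemma unroll_quotient (U : set (glue (square_side flip false))) :
  open (unroll @^-1` U) -> open U.
Proof.
move=> oU; apply: (square_pi_quotient oU) => v v1 v2.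
by rewrite /preimage/= unroll_square.
Qed.

Lemma unroll_surj w : exists v, unroll v = w.
Proof.
have [a <-] := glue_pi_surj w; exists (\val a.1, \val a.2).
by rewrite unroll_square ?square_pi_val//; exact: unit_interval_itv.
Qed.

End Unroll.

(** * Charts of compact subsets *)

Section SetType.
Variables (T : topologicalType) (K : set T).

Lemma set_type_hausdorff : hausdorff_space T -> hausdorff_space (set_type K).
Proof.
move=> hT; rewrite open_hausdorff => x y xy.
move: hT; rewrite open_hausdorff => /(_ (\val x) (\val y)).
rewrite (inj_eq val_inj) => /(_ xy)[[A B] /= [/set_mem Ax /set_mem By] [oA oB /eqP AB]].
exists (\val @^-1` A, \val @^-1` B) => /=; first by rewrite !inE.
split; [by exists A|by exists B|].
by rewrite -preimage_setI AB preimage_set0.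
Qed.

Lemma set_type_compact : compact K -> compact [set: set_type K].
Proof.
move=> cK F PF _; pose v := fun x : set_type K => \val x : T.
have FK : (v @ F) K.
  by apply: (@filterS _ F _ setT); [move=> x _; exact: set_valP|exact: filterT].
have [x [Kx clx]] := cK (v @ F) _ FK.
exists (SigSub (mem_set Kx)); split=> // A B FA.
rewrite nbhsE => -[_ [[O oO <-] /= Ox] OB].
have FvA : F (v @^-1` (v @` A)) by apply: (filterS _ FA) => a Aa; exists a.
have [y [[a Aa ay] Oy]] := clx _ _ FvA (open_nbhs_nbhs (conj oO Ox)).
by exists a; split=> //; apply: OB; rewrite /preimage/= -ay in Oy *.
Qed.

Lemma set_type_val_continuous : continuous (fun x : set_type K => \val x : T).
Proof. exact: initial_continuous. Qed.

Lemma set_type_continuous (S : topologicalType) (f : S -> set_type K) :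
  continuous (fun x => \val (f x) : T) -> continuous f.
Proof.
move=> /continuousP fc; apply/continuousP => _ [O oO <-].
exact: fc.
Qed.

End SetType.

(** A compact pseudometric space is second countable; [x0] provides the base point of the pointed
    structure. *)
Lemma set_type_second_countable (R : realType) (T : pseudoMetricType R) (K : set T)
    (x0 : set_type K) :
  compact K -> second_countable (T := set_type K).
Proof.
move=> cK.
pose P := HB.pack_for (pseudoPMetricType R) (set_type K) (isPointed.Build (set_type K) x0).
exact: (@compact_second_countable R P (set_type_compact cK)).
Qed.

(** * Coordinates in dimension three and continuity of formulas *)

Section Row3.
Variable R : realType.

Definition row3 (a b c : R) : 'rV[R]_3 := \row_j [:: a; b; c]`_j.

Definition idx1 : 'I_3 := Ordinal (isT : (1 < 3)%N).
Definition idx2 : 'I_3 := Ordinal (isT : (2 < 3)%N).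

Lemma row3_0 a b c : row3 a b c ord0 ord0 = a. Proof. by rewrite mxE. Qed.
Lemma row3_1 a b c : row3 a b c ord0 idx1 = b. Proof. by rewrite mxE. Qed.
Lemma row3_2 a b c : row3 a b c ord0 idx2 = c. Proof. by rewrite mxE. Qed.

Lemma row3_eta (v : 'rV[R]_3) : row3 (v ord0 ord0) (v ord0 idx1) (v ord0 idx2) = v.
Proof.
by apply/rowP => -[[|[|[|//]]] h]; rewrite mxE /=; congr (v _ _); exact: val_inj.
Qed.

Lemma row3_continuous_at (S : topologicalType) (a b c : S -> R) x :
  {for x, continuous a} -> {for x, continuous b} -> {for x, continuous c} ->
  {for x, continuous (fun x => row3 (a x) (b x) (c x))}.
Proof.
move=> ac bc cc A [B Bx BA].
have h (f : S -> R) j : {for x, continuous f} ->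
    row3 (a x) (b x) (c x) ord0 j = f x -> \forall y \near x, B ord0 j (f y).
  by move=> fc e; apply: fc; rewrite -e; exact: Bx.
have h0 := h a ord0 ac (row3_0 _ _ _).
have h1 := h b idx1 bc (row3_1 _ _ _).
have h2 := h c idx2 cc (row3_2 _ _ _).
apply: filterS (filterI h0 (filterI h1 h2)) => y [y0 [y1 y2]].
apply: BA => i j; rewrite (ord1 i) mxE.
by case: j => -[|[|[|//]]] hj /=;
  [move: y0|move: y1|move: y2]; congr (B _ _ _); exact: val_inj.
Qed.

Lemma row3_continuous (S : topologicalType) (a b c : S -> R) :
  continuous a -> continuous b -> continuous c ->
  continuous (fun x => row3 (a x) (b x) (c x)).
Proof. by move=> ac bc cc x; exact: (row3_continuous_at (ac x) (bc x) (cc x)). Qed.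

Lemma row_continuous (S : topologicalType) (f : S -> 'rV[R]_3) :
  (forall j, continuous (fun x => f x ord0 j)) -> continuous f.
Proof.
move=> fc; have -> : f = fun x => row3 (f x ord0 ord0) (f x ord0 idx1) (f x ord0 idx2).
  by apply/funext => x; rewrite row3_eta.
exact: row3_continuous.
Qed.

Lemma coord_cont (i : 'I_3) : continuous (fun v : 'rV[R]_3 => v ord0 i).
Proof. exact: coord_continuous. Qed.

End Row3.

Section RealContinuity.
Variables (R : realType) (S : topologicalType).
Implicit Types f g : S -> R.

Lemma cont_add f g : continuous f -> continuous g -> continuous (fun x => f x + g x).
Proof. by move=> fc gc x; apply: continuousD; [exact: fc|exact: gc]. Qed.

Lemma cont_opp f : continuous f -> continuous (fun x => - f x).
Proof. by move=> fc x; apply: continuousN; exact: fc. Qed.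

Lemma cont_mul f g : continuous f -> continuous g -> continuous (fun x => f x * g x).
Proof. by move=> fc gc x; apply: continuousM; [exact: fc|exact: gc]. Qed.

Lemma cont_sqr f : continuous f -> continuous (fun x => f x ^+ 2).
Proof.
by move=> fc; under eq_fun do rewrite expr2; exact: cont_mul.
Qed.

Lemma cont_sqrt f : continuous f -> continuous (fun x => Num.sqrt (f x)).
Proof.
move=> fc x; apply: (@continuous_comp _ _ _ f (@Num.sqrt R)); first exact: fc.
exact: sqrt_continuous.
Qed.

Lemma cont_fst (S1 S2 : topologicalType) (f : S -> S1 * S2) :
  continuous f -> continuous (fun x => (f x).1).
Proof.
by move=> fc x; apply: (@continuous_comp _ _ _ f fst); [exact: fc|exact: cvg_fst].
Qed.

Lemma cont_snd (S1 S2 : topologicalType) (f : S -> S1 * S2) :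
  continuous f -> continuous (fun x => (f x).2).
Proof.
by move=> fc x; apply: (@continuous_comp _ _ _ f snd); [exact: fc|exact: cvg_snd].
Qed.

Lemma cont_pair (S1 S2 : topologicalType) (f : S -> S1) (g : S -> S2) :
  continuous f -> continuous g -> continuous (fun x => (f x, g x)).
Proof. by move=> fc gc x; apply: continuous_pair; [exact: fc|exact: gc]. Qed.

Lemma cont_id : continuous (fun x : S => x).
Proof. by move=> x; exact: cvg_id. Qed.

Lemma open_pos f : continuous f -> open [set x | 0 < f x].
Proof. by move=> /continuousP fc; apply: (fc [set x | 0 < x]); exact: open_gt. Qed.

End RealContinuity.

Ltac cont :=
  lazymatch goal with
  | |- forall x, continuous_at x (fun y => @Algebra.add _ (@?f y) (@?g y)) =>
      apply: (@cont_add _ _ f g); cont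
  | |- forall x, continuous_at x (fun y => @Algebra.opp _ (@?f y)) =>
      apply: (@cont_opp _ _ f); cont
  | |- forall x, continuous_at x (fun y => @GRing.mul _ (@?f y) (@?g y)) =>
      apply: (@cont_mul _ _ f g); cont
  | |- forall x, continuous_at x (fun y => @GRing.exp _ (@?f y) _) =>
      first [exact: cst_continuous | apply: (@cont_sqr _ _ f); cont]
  | |- forall x, continuous_at x (fun y => Num.sqrt (@?f y)) =>
      apply: (@cont_sqrt _ _ f); cont
  | |- forall x, continuous_at x (fun y => fst (@?f y)) =>
      apply: (@cont_fst _ _ _ f); cont
  | |- forall x, continuous_at x (fun y => snd (@?f y)) =>
      apply: (@cont_snd _ _ _ f); cont
  | |- forall x, continuous_at x (fun y => pair (@?f y) (@?g y)) =>
      apply: (@cont_pair _ _ _ f g); cont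
  | |- forall x, continuous_at x (fun y => row3 (@?f y) (@?g y) (@?h y)) =>
      apply: (@row3_continuous _ _ f g h); cont
  | |- forall x, continuous_at x (fun y => y) => exact: cont_id
  | |- forall x, continuous_at x (fun y => fun_of_matrix y _ _) => exact: coord_cont
  | |- forall x, continuous_at x (fun y => _) => try exact: cst_continuous
  | |- _ => idtac
  end.

(** Lets charts of a subset be given by mutually inverse formulas in the ambient space; [x0] is the
    value of the inverse outside the image. *)
Lemma set_type_chart (R : realType) (n : nat) (T : topologicalType) (K : set T)
    (x0 : set_type K) (U : set T) (V : set 'rV[R]_n.+1)
    (f : T -> 'rV[R]_n.+1) (g : 'rV[R]_n.+1 -> T) :
  open U -> open V -> {within K `&` U, continuous f} ->
  {within V `&` half_space, continuous g} ->
  (forall x, K x -> U x -> (V `&` half_space) (f x) /\ g (f x) = x) ->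
  (forall v, (V `&` half_space) v -> [/\ K (g v), U (g v) & f (g v) = v]) ->
  exists c : boundary_chart R n (set_type K),
    chart_dom c = [set x | U (\val x)] /\ chart_map c = (fun x => f (\val x)).
Proof.
move=> oU oV fc gc fU gV.
have oU' : open [set x : set_type K | U (\val x)] by exists U.
pose g' v := insubd x0 (g v).
have g'E v : (V `&` half_space) v -> \val (g' v) = g v.
  by move=> /gV[Kg _ _]; rewrite insubdK//; exact/mem_set.
have Kval (x : set_type K) : K (\val x) by exact: set_valP.
suff h : exists2 V : set 'rV[R]_n.+1, open V &
    homeomorphism [set x : set_type K | U (\val x)] (V `&` half_space)
      (fun x => f (\val x)).
  by exists (@BoundaryChart R n _ _ _ oU' h).
exists V => //; apply: (@homeomorphism_can (set_type K) 'rV[R]_n.+1 _ _ (fun x => f (\val x)) g').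
- by move=> x Ux; have [] := fU _ (Kval x) Ux.
- by move=> v Vv; rewrite /= g'E//; have [] := gV _ Vv.
- move=> x Ux; have [Vx gfx] := fU _ (Kval x) Ux.
  by apply: val_inj; rewrite g'E.
- by move=> v Vv; rewrite g'E//; have [] := gV _ Vv.
- apply: (@within_comp _ _ _ _ (K `&` U) (fun x : set_type K => \val x) f) => //.
  exact/continuous_subspaceT/set_type_val_continuous.
- apply/within_openP => v _ Vv [O oO <-].
  rewrite /preimage/= set_valE g'E// => Ov.
  have /within_openP/(_ v O Vv oO Ov)[N [oN Nv NO]] := gc.
  by exists N; split=> // v' Nv' Vv'; rewrite /preimage/= ?set_valE g'E//; exact: NO.
Qed.

(** * The solid torus *)

Section SolidTorus.
Variable R : realType.
Local Notation plane := (R * R)%type.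

Definition solid_torus_set : set (plane * plane) :=
  [set v | v.1.1 ^+ 2 + v.1.2 ^+ 2 <= 1 /\ v.2.1 ^+ 2 + v.2.2 ^+ 2 = 1].

Definition solid_torus : Type := set_type solid_torus_set.
HB.instance Definition _ := Topological.on solid_torus.

Definition torus_surface : set solid_torus :=
  [set y | (\val y).1.1 ^+ 2 + (\val y).1.2 ^+ 2 = 1].

Lemma solid_torusP (y : solid_torus) : solid_torus_set (\val y).
Proof. exact: set_valP. Qed.

Lemma sqr_sum_le1 (x y : R) : x ^+ 2 + y ^+ 2 <= 1 -> -1 <= x <= 1.
Proof.
move=> h; have y0 := sqr_ge0 y; rewrite -ler_norml.
by rewrite -(@ler_sqr _ `|x| 1) ?nnegrE// real_normK ?num_real// expr1n; lra.
Qed.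

Lemma solid_torus_compact_set : compact solid_torus_set.
Proof.
have c1 : compact (`[-1, 1]%classic : set R) by exact: segment_compact.
have cbox := compact_setX (compact_setX c1 c1) (compact_setX c1 c1).
apply: (subclosed_compact _ cbox).
  have -> : solid_torus_set =
      (fun v : plane * plane => v.1.1 ^+ 2 + v.1.2 ^+ 2) @^-1` [set x | x <= 1] `&`
      (fun v : plane * plane => v.2.1 ^+ 2 + v.2.2 ^+ 2) @^-1` [set x | x = 1].
    by [].
  apply: closedI; apply: closed_comp.
  - by move=> x _; move: x; cont.
  - exact: closed_le.
  - by move=> x _; move: x; cont.
  - exact: closed_eq.
move=> [[a b] [c d]] /= [h1 h2]; rewrite /solid_torus_set/= !in_itv/=.
by split; split;
  [apply: (sqr_sum_le1 (y := b))|apply: (sqr_sum_le1 (y := a)); rewrite addrC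
  |apply: (sqr_sum_le1 (y := d))|apply: (sqr_sum_le1 (y := c)); rewrite addrC]; rewrite ?h2.
Qed.

Lemma solid_torus_compact : compact [set: solid_torus].
Proof. exact/set_type_compact/solid_torus_compact_set. Qed.

Lemma solid_torus_hausdorff : hausdorff_space solid_torus.
Proof. by apply: set_type_hausdorff; exact: norm_hausdorff. Qed.

Lemma solid_torus_second_countable : second_countable (T := solid_torus).
Proof.
have h : solid_torus_set ((0, 0), (1, 0)).
  by split; rewrite /= ?expr0n ?expr1n /= ?addr0.
exact: (set_type_second_countable (SigSub (mem_set h)) solid_torus_compact_set).
Qed.

(* The two coordinates of [z] in the orthonormal frame [u], [i u] of the plane. *)
Definition along (u z : plane) : R := z.1 * u.1 + z.2 * u.2.
Definition across (u z : plane) : R := z.2 * u.1 - z.1 * u.2.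
Definition in_frame (u : plane) (a b : R) : plane :=
  (a * u.1 - b * u.2, a * u.2 + b * u.1).

Section Frame.
Variable u : plane.
Hypothesis u1 : u.1 ^+ 2 + u.2 ^+ 2 = 1.

Lemma along_in_frame a b : along u (in_frame u a b) = a.
Proof.
rewrite /along /in_frame /=.
rewrite -[RHS]mulr1 -u1; ring.
Qed.

Lemma across_in_frame a b : across u (in_frame u a b) = b.
Proof.
rewrite /across /in_frame /=.
rewrite -[RHS]mulr1 -u1; ring.
Qed.

Lemma in_frame_along z : in_frame u (along u z) (across u z) = z.
Proof.
case: z => x y; rewrite /along /across /in_frame /=; congr pair.
  by rewrite -[RHS]mulr1 -u1; ring.
by rewrite -[RHS]mulr1 -u1; ring.
Qed.

Lemma sqr_in_frame a b :
  (in_frame u a b).1 ^+ 2 + (in_frame u a b).2 ^+ 2 = a ^+ 2 + b ^+ 2.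
Proof.
by rewrite /in_frame /= -[RHS]mulr1 -u1; ring.
Qed.

Lemma sqr_along z : along u z ^+ 2 + across u z ^+ 2 = z.1 ^+ 2 + z.2 ^+ 2.
Proof. by rewrite -sqr_in_frame in_frame_along. Qed.

End Frame.

Lemma along_self u : u.1 ^+ 2 + u.2 ^+ 2 = 1 -> along u u = 1.
Proof. by rewrite /along -!expr2. Qed.

Lemma frame_sqrt u z c : u.1 ^+ 2 + u.2 ^+ 2 = 1 -> 0 < along u z ->
  c = z.1 ^+ 2 + z.2 ^+ 2 ->
  in_frame u (Num.sqrt (c - across u z ^+ 2)) (across u z) = z.
Proof.
move=> u1 z0 ->; rewrite -(sqr_along u1) addrK sqrtr_sqr gtr0_norm//.
exact: in_frame_along.
Qed.

Lemma solid_torus_charted : charted (R := R) 2 torus_surface.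
Proof.
move=> y0; have [] := solid_torusP y0.
set u := (\val y0).1; set w := (\val y0).2 => hu hw.
pose x0 : set_type solid_torus_set := y0.
have alongc (v : plane) : continuous (fun x : plane * plane => along v x.1).
  by rewrite /along; cont.
have alongc2 (v : plane) : continuous (fun x : plane * plane => along v x.2).
  by rewrite /along; cont.
move: hu; rewrite le_eqVlt => /predU1P[hu|hu].
(* At a boundary point the height is 1 - |z|^2, which vanishes exactly on the surface. The other
   coordinates are the components across [u] and [w]; the components along them are positive on [U]
   and are recovered as square roots. *)
- pose U : set (plane * plane) := [set x | 0 < along u x.1] `&` [set x | 0 < along w x.2].
  pose V : set 'rV[R]_3 := [set v | 0 < 1 - v ord0 ord0 - v ord0 idx1 ^+ 2] `&`
     [set v | 0 < 1 - v ord0 idx2 ^+ 2].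
  pose f (x : plane * plane) := row3 (1 - (x.1.1 ^+ 2 + x.1.2 ^+ 2))
     (across u x.1) (across w x.2).
  pose g (v : 'rV[R]_3) : plane * plane :=
    (in_frame u (Num.sqrt (1 - v ord0 ord0 - v ord0 idx1 ^+ 2)) (v ord0 idx1),
     in_frame w (Num.sqrt (1 - v ord0 idx2 ^+ 2)) (v ord0 idx2)).
  have oU : open U by apply: openI; apply: open_pos.
  have oV : open V by apply: openI; apply: open_pos; cont.
  have [||x [Kx1 Kx2] [Ux1 Ux2]|v [[Vv1 Vv2] Hv]|c [dc mc]] :=
      @set_type_chart R 2 _ solid_torus_set x0 U V f g oU oV.
  + by apply: continuous_subspaceT; rewrite /f /across; cont.
  + by apply: continuous_subspaceT; rewrite /g /in_frame; cont.
  + rewrite /f; split.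
      split; last by rewrite /half_space /= row3_0 subr_ge0.
      split; rewrite /= ?row3_0 ?row3_1 ?row3_2.
        by rewrite subKr -(sqr_along hu) addrK exprn_gt0.
      by rewrite -Kx2 -(sqr_along hw) addrK exprn_gt0.
    rewrite /g row3_0 row3_1 row3_2 frame_sqrt ?subKr//.
    by rewrite frame_sqrt// -surjective_pairing.
  + rewrite /= in Vv1 Vv2 Hv.
    have e1 : (Num.sqrt (1 - v ord0 ord0 - v ord0 idx1 ^+ 2)) ^+ 2 =
      1 - v ord0 ord0 - v ord0 idx1 ^+ 2 by rewrite sqr_sqrtr// ltW.
    have e2 : (Num.sqrt (1 - v ord0 idx2 ^+ 2)) ^+ 2 = 1 - v ord0 idx2 ^+ 2.
      by rewrite sqr_sqrtr// ltW.
    split.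
    * split.
        have := sqr_in_frame hu (Num.sqrt (1 - v ord0 ord0 - v ord0 idx1 ^+ 2)) (v ord0 idx1).
        by rewrite e1 subrK => h; rewrite /g h gerBl.
      have := sqr_in_frame hw (Num.sqrt (1 - v ord0 idx2 ^+ 2)) (v ord0 idx2).
      by rewrite e2 subrK => h; rewrite /g h.
    * by split; rewrite /= along_in_frame// sqrtr_gt0.
    * have := sqr_in_frame hu (Num.sqrt (1 - v ord0 ord0 - v ord0 idx1 ^+ 2)) (v ord0 idx1).
      rewrite e1 subrK => h; rewrite /f h !across_in_frame//.
      by rewrite subKr row3_eta.
  + exists c; rewrite dc mc; split.
      by split; rewrite /= along_self.
    move=> y Uy; rewrite row3_0 /torus_surface /=.
    by split=> [/eqP|->]; rewrite ?subrr// subr_eq0 => /eqP <-.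
- pose U : set (plane * plane) := [set x | 0 < 1 - (x.1.1 ^+ 2 + x.1.2 ^+ 2)] `&`
     [set x | 0 < along w x.2].
  (* At an interior point, the translation by 2 puts the open unit disc inside the open half-space,
     so this chart avoids height 0. *)
  pose V : set 'rV[R]_3 := [set v | 0 < 1 - ((v ord0 ord0 - 2) ^+ 2 + v ord0 idx1 ^+ 2)] `&`
     [set v | 0 < 1 - v ord0 idx2 ^+ 2].
  pose f (x : plane * plane) := row3 (x.1.1 + 2) x.1.2 (across w x.2).
  pose g (v : 'rV[R]_3) : plane * plane :=
    ((v ord0 ord0 - 2, v ord0 idx1),
     in_frame w (Num.sqrt (1 - v ord0 idx2 ^+ 2)) (v ord0 idx2)).
  have oU : open U by apply: openI; apply: open_pos; cont.
  have oV : open V by apply: openI; apply: open_pos; cont.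
  have pos (x : R * R) : 0 < 1 - (x.1 ^+ 2 + x.2 ^+ 2) -> 0 < x.1 + 2 by nra.
  have [||x [Kx1 Kx2] [Ux1 Ux2]|v [[Vv1 Vv2] Hv]|c [dc mc]] :=
      @set_type_chart R 2 _ solid_torus_set x0 U V f g oU oV.
  + by apply: continuous_subspaceT; rewrite /f /across; cont.
  + by apply: continuous_subspaceT; rewrite /g /in_frame; cont.
  + rewrite /f; split.
      split; last by rewrite /half_space /= row3_0 ltW// pos.
      split; rewrite /= ?row3_0 ?row3_1 ?row3_2 ?addrK//.
      by rewrite -Kx2 -(sqr_along hw) addrK exprn_gt0.
    rewrite /g row3_0 row3_1 row3_2 addrK -surjective_pairing.
    by rewrite frame_sqrt// -surjective_pairing.
  + rewrite /= in Vv1 Vv2 Hv.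
    have e2 : (Num.sqrt (1 - v ord0 idx2 ^+ 2)) ^+ 2 = 1 - v ord0 idx2 ^+ 2.
      by rewrite sqr_sqrtr// ltW.
    split.
    * split; first by rewrite /g /= -subr_ge0 ltW.
      have := sqr_in_frame hw (Num.sqrt (1 - v ord0 idx2 ^+ 2)) (v ord0 idx2).
      by rewrite e2 subrK => h; rewrite /g h.
    * by split; rewrite /= ?along_in_frame// sqrtr_gt0.
    * by rewrite /f across_in_frame//= subrK row3_eta.
  + exists c; rewrite dc mc; split.
      by split; rewrite /= ?along_self// subr_gt0.
    move=> y [Uy _]; rewrite row3_0 /torus_surface /=; split.
      by move/eqP; rewrite gt_eqF//; exact: pos Uy.
    by move=> e; move: Uy; rewrite /= e subrr ltxx.
Qed.

End SolidTorus.

(** * The circle, with angles counted in turns *)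

Section Circle.
Variable R : realType.
Local Notation plane := (R * R)%type.
Implicit Types t : R.

Definition circle t : plane := (cos (2 * pi * t), sin (2 * pi * t)).

Definition cmul (u z : plane) : plane := in_frame u z.1 z.2.

Lemma circle_sqr t : (circle t).1 ^+ 2 + (circle t).2 ^+ 2 = 1.
Proof. exact: cos2Dsin2. Qed.

Lemma cmul_circle t t' : cmul (circle t) (circle t') = circle (t + t').
Proof.
by rewrite /cmul /in_frame /circle /= (mulrDr (2 * pi) t t') cosD sinD; congr pair; ring.
Qed.

Lemma circleN t : circle (- t) = ((circle t).1, - (circle t).2).
Proof. by rewrite /circle mulrN cosN sinN. Qed.

Lemma circle0 : circle 0 = (1, 0).
Proof. by rewrite /circle mulr0 cos0 sin0. Qed.

Lemma circle1 : circle 1 = (1, 0).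
Proof. by rewrite /circle mulr1 mulrC mulr_natr cos2pi sin2pi. Qed.

Lemma cmul1 z : cmul (1, 0) z = z.
Proof. by case: z => x y; rewrite /cmul /in_frame /=; congr pair; ring. Qed.

Lemma circle_add1 t : circle (t + 1) = circle t.
Proof. by rewrite addrC -cmul_circle circle1 cmul1. Qed.

Lemma circle_continuous : continuous circle.
Proof.
have c2 : continuous (fun t : R => 2 * pi * t) by cont.
apply: cont_pair => t; apply: (@continuous_comp _ _ _ (fun t => 2 * pi * t));
  by [exact: c2|exact: continuous_cos|exact: continuous_sin].
Qed.

(** The cosine is injective on the first half turn; in the second half, [1 - t] has the same cosine
    and would be 0. *)
Lemma circle_eq1 t : 0 <= t < 1 -> circle t = (1, 0) -> t = 0.
Proof.
move=> /andP[t0 t1] [c1 _]; have pi0 := pi_gt0 R.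
have h (u : R) : 0 <= u <= 1 / 2 -> cos (2 * pi * u) = 1 -> u = 0.
  move=> /andP[u0 u1] cu.
  have : 2 * pi * u = 0.
    rewrite -(@cosK _ (2 * pi * u)); last first.
      have := mulr_ge0 (ltW pi0) u0; have := ler_wpM2l (ltW pi0) u1.
      by rewrite in_itv /= => h1 h2; apply/andP; split; lra.
    by rewrite cu acos1.
  by move=> h0; apply: (@mulfI _ (2 * pi)); rewrite ?mulr0// gt_eqF// mulr_gt0.
have [t2|t2] := leP t (1 / 2); first by apply: h => //; rewrite t0.
have e : cos (2 * pi * (1 - t)) = 1.
  by have := circle_add1 (- t); rewrite circleN addrC => -[-> _].
by have : 1 - t = 0; [apply: h => //; apply/andP; split; lra|lra].
Qed.

Lemma circle_add_int t (i : int) : circle (t + i%:~R) = circle t.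
Proof.
elim/int_rect: i => [|n IH|n IH]; first by rewrite addr0.
- by rewrite -IH -[RHS]circle_add1 -addrA -addn1 PoszD intrD.
- by rewrite -IH -[LHS]circle_add1 -addrA -addn1 PoszD opprD intrD subrK.
Qed.

Lemma circle_inj t t' : circle t = circle t' -> exists i : int, t' = t + i%:~R.
Proof.
move=> e; exists (Num.floor (t' - t)).
have c1 : circle (frac (t' - t)) = (1, 0).
  rewrite -(circle_add_int _ (Num.floor (t' - t))) subrK.
  by rewrite -cmul_circle circleN e -circleN cmul_circle subrr circle0.
have := circle_eq1 (frac_itv _) c1; rewrite /frac => h.
by apply/eqP; rewrite -subr_eq0 opprD addrA h.
Qed.

Lemma pi2_neq0 : 2 * pi != 0 :> R.
Proof. by rewrite gt_eqF// mulr_gt0// pi_gt0. Qed.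

Lemma circle_surj (z : plane) : z.1 ^+ 2 + z.2 ^+ 2 = 1 -> exists t, circle t = z.
Proof.
case: z => x y /= h; have pi0 := pi_gt0 R.
have x1 : -1 <= x <= 1 by apply: (@sqr_sum_le1 _ x y); rewrite h.
pose t := acos x / (2 * pi).
have tE : 2 * pi * t = acos x by rewrite /t mulrC divfK// pi2_neq0.
have y2 : 1 - x ^+ 2 = y ^+ 2 by rewrite -h; ring.
have ct : circle t = (x, `|y|).
  by rewrite /circle tE acosK ?in_itv// sin_acos// y2 sqrtr_sqr.
have [y0|y0] := leP 0 y; first by exists t; rewrite ct ger0_norm.
by exists (- t); rewrite circleN ct /= ltr0_norm// opprK.
Qed.

Lemma across_self (u : plane) : across u u = 0.
Proof. by rewrite /across mulrC subrr. Qed.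

(* A continuous branch of the inverse of [circle] around [circle t0]. *)
Definition circle_arg t0 (z : plane) : R :=
  t0 + asin (across (circle t0) z) / (2 * pi).

Lemma circle_arg_self t0 : circle_arg t0 (circle t0) = t0.
Proof.
rewrite /circle_arg across_self -[X in asin X]sin0 sinK ?mul0r ?addr0//.
by have := pi_ge0 R; rewrite in_itv /= => h; apply/andP; split; lra.
Qed.

Lemma circle_circle_arg t0 z : z.1 ^+ 2 + z.2 ^+ 2 = 1 ->
  0 < along (circle t0) z -> circle (circle_arg t0 z) = z.
Proof.
move=> z1 z0; have pi0 := pi_gt0 R; rewrite /circle_arg -cmul_circle.
set rho := across _ z.
have h := sqr_along (circle_sqr t0) z; rewrite z1 in h.
have rho1 : -1 <= rho <= 1.
  by apply: (@sqr_sum_le1 _ rho (along (circle t0) z)); rewrite addrC h.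
have tE : 2 * pi * (asin rho / (2 * pi)) = asin rho.
  by rewrite mulrC divfK// pi2_neq0.
rewrite /circle tE asinK ?in_itv// cos_asin//.
rewrite -[RHS](in_frame_along (circle_sqr t0)) /cmul /=; congr in_frame.
by rewrite -h -/rho addrK sqrtr_sqr gtr0_norm.
Qed.

Lemma circle_arg_continuous t0 : {for circle t0, continuous (circle_arg t0)}.
Proof.
apply: (@continuousD _ _ _ (fun=> t0)); first exact: cst_continuous.
apply: (@continuousM _ _ _ (fun=> (2 * pi)^-1)); last exact: cst_continuous.
apply: (@continuous_comp _ _ _ (across (circle t0)) (@asin R)).
  have h : continuous (fun z => across (circle t0) z) by rewrite /across; cont.
  exact: h.
rewrite /prop_for across_self; apply: continuous_asin.
by apply/andP; split; lra.
Qed.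

End Circle.

(** * Orbits of two maps of finite order *)

Section IterOrbit.
Variables (X : Type) (A B : X -> X) (m n e : nat).
Hypotheses (m_gt0 : (0 < m)%N) (n_gt0 : (0 < n)%N).
Hypothesis iterA : forall x, iter m A x = x.
Hypothesis iterB : forall x, iter n B x = x.
Hypothesis AB : forall x, A (B x) = iter e B (A x).

Lemma iter_mul_id (f : X -> X) d k x : (forall x, iter d f x = x) ->
  iter (k * d) f x = x.
Proof. by move=> h; elim: k => // k IH; rewrite mulSn iterD IH h. Qed.

Lemma iter_modn (f : X -> X) d k x : (forall x, iter d f x = x) ->
  iter (k %% d) f x = iter k f x.
Proof. by move=> h; rewrite [in RHS](divn_eq k d) addnC iterD iter_mul_id. Qed.

Lemma A_iterB l x : A (iter l B x) = iter (e * l) B (A x).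
Proof. by elim: l => [|l IH]; rewrite ?muln0//= AB IH -iterD mulnS. Qed.

Let orbit x y := exists k l : nat, y = iter l B (iter k A x).

Let orbitA x y : orbit x y -> orbit x (A y).
Proof. by move=> [k [l ->]]; exists k.+1, (e * l)%N; rewrite A_iterB. Qed.

Let orbitB x y : orbit x y -> orbit x (B y).
Proof. by move=> [k [l ->]]; exists k, l.+1. Qed.

Let orbit_trans x y z : orbit x y -> orbit y z -> orbit x z.
Proof.
move=> xy [k [l ->]]; elim: l => [|l IH] /=; last exact: orbitB.
by elim: k => //= k IH; exact: orbitA.
Qed.

Let orbit_sym x y : orbit x y -> orbit y x.
Proof.
move=> [k [l ->]]; apply: (@orbit_trans _ (iter k A x)).
  (* Inverses are positive iterates: these steps complete [l] to [l * n], a multiple of the order.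
     The natural subtraction is exact because [n] is positive. *)
  exists 0%N, (l * n - l)%N; rewrite /= -iterD subnK ?iter_mul_id//.
  by rewrite -[leqLHS]muln1 leq_mul2l n_gt0 orbT.
exists (k * m - k)%N, 0%N; rewrite /= -iterD subnK ?iter_mul_id//.
by rewrite -[leqLHS]muln1 leq_mul2l m_gt0 orbT.
Qed.

(** The relation [AB] sorts every word into iterates of [A] followed by iterates of [B], and the
    finite orders bound the exponents. The classes become orbits of a family indexed by a finite
    type, as [FreeQuotient] requires. *)
Lemma iter_orbitP x y :
  clos_refl_sym_trans X (fun x y => y = A x \/ y = B x) x y <->
  exists kl : 'I_m * 'I_n, y = iter kl.2 B (iter kl.1 A x).
Proof.
split=> [xy|[[k l] /= ->]]; last first.
  have step f z : f = A \/ f = B ->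
      clos_refl_sym_trans X (fun x y => y = A x \/ y = B x) z (f z).
    by move=> [->|->]; apply: rst_step; [left|right].
  apply: (rst_trans _ _ _ (iter k A x)).
    elim: (k : nat) => [|j IH]; first exact: rst_refl.
    by apply: rst_trans IH _ => /=; apply: (step A); left.
  elim: (l : nat) => [|j IH]; first exact: rst_refl.
  by apply: rst_trans IH _ => /=; apply: (step B); right.
have [k [l ->]] : orbit x y.
  elim: xy => {x y} [x y [->|->]|x|x y _|x y z _ + _].
  - by exists 1%N, 0%N.
  - by exists 0%N, 1%N.
  - by exists 0%N, 0%N.
  - exact: orbit_sym.
  - exact: orbit_trans.
exists (Ordinal (ltn_pmod k m_gt0), Ordinal (ltn_pmod l n_gt0)) => /=.
by rewrite !iter_modn.
Qed.

End IterOrbit.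

(** * Bundles over the torus and the Klein bottle *)

Lemma plane_lift_const (gT : finGroupType) (Q M : topologicalType)
    (to : {action gT &-> Q}) (p : Q -> M) (R : realType) (s1 s2 : R * R -> Q) :
  principal_bundle to p -> continuous s1 -> continuous s2 ->
  (forall v, p (s1 v) = p (s2 v)) -> exists g, forall v, s2 v = to (s1 v) g.
Proof.
move=> pb c1 c2 e; have [g eg] := bundle_transitive pb (e (0, 0)).
exists g => v; pose path t : R * R := (t * v.1, t * v.2).
have pathc : continuous path by rewrite /path; cont.
have cp s : continuous s -> continuous (s \o path : R -> Q).
  by move=> sc t; apply: continuous_comp; [exact: pathc|exact: sc].
have path1 : path 1 = v by rewrite /path !mul1r -surjective_pairing.
have path0 : path 0 = (0, 0) by rewrite /path !mul0r.
rewrite -path1; apply: (@lift_unique _ _ _ _ _ pb R (s1 \o path) (s2 \o path) 0 g).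
- exact: cp.
- exact: cp.
- by move=> t; exact: e.
- by rewrite /= path0.
Qed.

Lemma homeomorphism_setT (X Y : topologicalType) (h : X -> Y) :
  homeomorphism [set: X] [set: Y] h -> exists g : Y -> X,
  [/\ continuous h, continuous g, cancel h g & cancel g h].
Proof.
move=> hh; have [g [_ hK gK gc]] := homeomorphism_inv hh.
have [_ hc _] := hh.
exists g; split; [|  | by move=> x; exact: hK|by move=> y; exact: gK].
- exact/continuous_subspace_setT.
- exact/continuous_subspace_setT.
Qed.

Lemma discrete_continuous (gT : finGroupType) (S : topologicalType)
    (f : discrete_topology gT -> S) : continuous f.
Proof.
move=> k; apply/cvg_openP => O oO Ok; exists [set k]; split=> //.
  by rewrite openE => _ ->; exact: discrete_set1.
by move=> _ ->.
Qed.

Lemma iter_continuous (S : topologicalType) (f : S -> S) k :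
  continuous f -> continuous (iter k f).
Proof.
move=> fc; elim: k => [|k IH] x; first exact: cvg_id.
by apply: (@continuous_comp _ _ _ (iter k f) f); [exact: IH|exact: fc].
Qed.

Section TorusKlein.
Context {R : realType} {gT : finGroupType} {Q M : topologicalType}.
Variables (to : {action gT &-> Q}) (p : Q -> M) (flip : bool).
Variable h : glue (@square_side R flip false) -> M.
Hypothesis h_homeo : homeomorphism setT setT h.
Hypothesis pb : principal_bundle to p.
Local Notation sigma := ((-1) ^+ flip : R).
Local Notation E := (fun v => h (unroll flip v)).
Local Notation plane := (R * R)%type.

Variable s : plane -> Q.
Hypothesis s_cont : continuous s.
Hypothesis sE : forall v, p (s v) = E v.
Variables a b : gT.
Hypothesis s_horizontal : forall x y, s (x + 1, sigma * y) = to (s (x, y)) a.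
Hypothesis s_vertical : forall x y, s (x, y + 1) = to (s (x, y)) b.

(* The order of [b] exactly, so that no nontrivial power of the rotation by 1/n
   fixes the core of the solid torus together with an element of the group; the
   factor 2 in [m] makes the m-th power of the reflection trivial. *)
Let n := #[b]%g.
Let m := (2 * #[a]%g)%N.

Let n_gt0 : (0 < n)%N. Proof. exact: order_gt0. Qed.
Let m_gt0 : (0 < m)%N. Proof. by rewrite muln_gt0 order_gt0. Qed.
Let nR : n%:R != 0 :> R. Proof. by rewrite pnatr_eq0 -lt0n. Qed.
Let mR : m%:R != 0 :> R. Proof. by rewrite pnatr_eq0 -lt0n. Qed.

Local Notation Y := (solid_torus R).
Local Notation X := (solid_torus R * discrete_topology gT)%type.

Let base_subproof : solid_torus_set (((1, 0), (1, 0)) : plane * plane).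
Proof. by split; rewrite /= ?expr0n ?expr1n /= ?addr0. Qed.

Let base_point : Y := SigSub (mem_set base_subproof).

Let insubY (v : plane * plane) : Y := insubd base_point v.

Let val_insubY v : solid_torus_set v -> \val (insubY v) = v.
Proof. by move=> Sv; rewrite /insubY insubdK//; exact: mem_set. Qed.

Let Y_eq (y y' : Y) : \val y = \val y' :> plane * plane -> y = y'.
Proof. exact: val_inj. Qed.

(* Deck transformations of the solid torus, finite order versions of
   (x, y) |-> (x + 1, sigma y) and (x, y) |-> (x, y + 1) on the universal cover of
   its boundary. *)
Let turnA (k : nat) (v : plane * plane) : plane * plane :=
  ((v.1.1, sigma ^+ k * v.1.2), cmul (circle (k%:R / m%:R)) v.2).
Let turnB (l : nat) (v : plane * plane) : plane * plane :=
  (cmul (circle (l%:R / n%:R)) v.1, v.2).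

Let sqr_cmul t (z : plane) :
  (cmul (circle t) z).1 ^+ 2 + (cmul (circle t) z).2 ^+ 2 = z.1 ^+ 2 + z.2 ^+ 2.
Proof. by rewrite /cmul sqr_in_frame//; exact: circle_sqr. Qed.

Let cmul_cmul t t' (z : plane) :
  cmul (circle t) (cmul (circle t') z) = cmul (circle (t + t')) z.
Proof.
rewrite -cmul_circle; rewrite /cmul /in_frame /=; congr pair; ring.
Qed.

Let sigma_exp_sqr k : (sigma ^+ k) ^+ 2 = 1.
Proof. by rewrite exprAC sqrr_sign expr1n. Qed.

Let turnA_torus k v : solid_torus_set v -> solid_torus_set (turnA k v).
Proof. by move=> [h1 h2]; split; rewrite /= ?sqr_cmul// exprMn sigma_exp_sqr mul1r. Qed.

Let turnB_torus l v : solid_torus_set v -> solid_torus_set (turnB l v).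
Proof. by move=> [h1 h2]; split; rewrite /= ?sqr_cmul. Qed.

Let turnA_add k k' v : turnA k (turnA k' v) = turnA (k + k') v.
Proof. by rewrite /turnA /= cmul_cmul mulrA -exprD natrD mulrDl. Qed.

Let turnB_add k k' v : turnB k (turnB k' v) = turnB (k + k') v.
Proof. by rewrite /turnB /= cmul_cmul natrD mulrDl. Qed.

Let turnA0 v : turnA 0 v = v.
Proof. by case: v => [[? ?] [? ?]]; rewrite /turnA expr0 mul1r mul0r circle0 cmul1. Qed.

Let turnB0 v : turnB 0 v = v.
Proof. by case: v => [[? ?] [? ?]]; rewrite /turnB mul0r circle0 cmul1. Qed.

Let turnAm v : turnA m v = v.
Proof.
case: v => [[? ?] [? ?]].
by rewrite /turnA divff// circle1 cmul1 /m exprM sqrr_sign expr1n mul1r.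
Qed.

Let turnBn v : turnB n v = v.
Proof. by case: v => [[? ?] [? ?]]; rewrite /turnB divff// circle1 cmul1. Qed.

Definition mapA (x : X) : X := (insubY (turnA 1 (\val x.1)), (a^-1 * x.2)%g).
Definition mapB (x : X) : X := (insubY (turnB 1 (\val x.1)), (b^-1 * x.2)%g).

Let iter_mapA k x :
  iter k mapA x = (insubY (turnA k (\val x.1)), (a ^- k * x.2)%g).
Proof.
have Sx := solid_torusP x.1.
elim: k => [|k IH].
  rewrite turnA0 expg0 invg1 mul1g [LHS]surjective_pairing; congr pair.
  by apply: Y_eq; rewrite val_insubY.
rewrite iterS IH /mapA /= val_insubY ?turnA_add ?add1n; last exact: turnA_torus.
by rewrite expgSr invMg mulgA.
Qed.

Let iter_mapB l x :
  iter l mapB x = (insubY (turnB l (\val x.1)), (b ^- l * x.2)%g).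
Proof.
have Sx := solid_torusP x.1.
elim: l => [|k IH].
  rewrite turnB0 expg0 invg1 mul1g [LHS]surjective_pairing; congr pair.
  by apply: Y_eq; rewrite val_insubY.
rewrite iterS IH /mapB /= val_insubY ?turnB_add ?add1n; last exact: turnB_torus.
by rewrite expgSr invMg mulgA.
Qed.

Let iter_mapA_m x : iter m mapA x = x.
Proof.
rewrite iter_mapA turnAm [RHS]surjective_pairing; congr pair.
  by apply: Y_eq; rewrite val_insubY//; exact: solid_torusP.
by rewrite /m mulnC expgM expg_order expg1n invg1 mul1g.
Qed.

Let iter_mapB_n x : iter n mapB x = x.
Proof.
rewrite iter_mapB turnBn [RHS]surjective_pairing; congr pair.
  by apply: Y_eq; rewrite val_insubY//; exact: solid_torusP.
by rewrite /n expg_order invg1 mul1g.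
Qed.

(** [b ^+ e] is [b] for the torus and the inverse of [b] for the Klein bottle, written as a power
    with natural exponent since [iter_orbitP] counts iterates. *)
Let e := if flip then n.-1 else 1%N.

Let ab_relation : (b * a = a * b ^+ e)%g.
Proof.
have [fl|fl] : ~~ flip \/ flip by case: flip; [right|left].
  rewrite /e (negbTE fl) expg1.
  apply: (bundle_free pb (q := s (0, 0))).
  rewrite !total_actM -s_vertical -!s_horizontal -s_vertical.
  by rewrite (negbTE fl) expr0 !mul1r.
(* From the origin, a step up, a horizontal step, which reflects, and a step up again lead to (1,
   0), as the horizontal step alone does. *)
have ae : (a = b * a * b)%g.
  apply: (bundle_free pb (q := s (0, 0))).
  rewrite !total_actM -s_vertical -!s_horizontal -s_vertical.
  by rewrite fl expr1 !mulN1r !add0r oppr0 addNr.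
rewrite /e fl {2}ae -!mulgA -expgS prednK// expg_order mulg1//.
Qed.

Let mapAB x : mapA (mapB x) = iter e mapB (mapA x).
Proof.
have Sx := solid_torusP x.1.
rewrite iter_mapB /mapA /mapB /=; congr pair; last first.
  rewrite !mulgA; congr mulg.
  by rewrite -!invMg; congr (_^-1)%g; exact: ab_relation.
rewrite !val_insubY//; [|exact: turnA_torus|exact: turnB_torus].
congr insubY; rewrite /turnA /turnB /= !expr1; congr pair.
have [fl|fl] : ~~ flip \/ flip by case: flip; [right|left].
  have -> : sigma = 1 by rewrite (negbTE fl) expr0.
  by rewrite /e (negbTE fl) !mul1r -!surjective_pairing.
have -> : sigma = -1 by rewrite fl expr1.
rewrite /e fl.
(* Conjugating the disc reverses its rotation, and [n.-1] rotations by 1/n amount to one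
   backward. *)
have -> : circle (n.-1%:R / n%:R) = circle (- (1%:R / n%:R)) :> plane.
  rewrite -[RHS]circle_add1; congr circle.
  have hn : n%:R = n.-1%:R + 1 :> R by rewrite natr1 prednK.
  by apply: (mulIf nR); rewrite mulrDl mulNr !divfK// mulr1n mul1r hn addrCA addNr addr0.
by rewrite circleN /cmul /in_frame /= ?mulr1n; congr pair; ring.
Qed.

Let r (x y : X) := y = mapA x \/ y = mapB x.

Let T (kl : 'I_m * 'I_n) (x : X) : X := iter kl.2 mapB (iter kl.1 mapA x).

Let glue_T x y : glue_eq r x y <-> exists kl, y = T kl x.
Proof.
apply: (iff_trans (glue_eqP _ _ _)).
exact: (iter_orbitP m_gt0 n_gt0 iter_mapA_m iter_mapB_n mapAB).
Qed.

Let TE kl x : T kl x =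
  (insubY (turnB kl.2 (turnA kl.1 (\val x.1))), (b ^- kl.2 * (a ^- kl.1 * x.2))%g).
Proof.
rewrite /T iter_mapB iter_mapA /= val_insubY//; apply: turnA_torus; exact: solid_torusP.
Qed.

(** The circle factor turns by k/m with k < m, which forces k = 0. The group factor is then
    multiplied by [b ^- l] with l below the order of [b], which forces l = 0. The disc factor gives
    no information at its centre. *)
Let T_free kl x : T kl x = x -> forall y, T kl y = y.
Proof.
have Sx := solid_torusP x.1.
case: kl => -[k km] [l ln] => e0.
have k0 : k = 0%N.
  have := congr1 (fun x : X => \val x.1 : plane * plane) e0.
  rewrite TE /= val_insubY; last exact/turnB_torus/turnA_torus.
  move=> /(congr1 snd) /= ek.
  have c1 : circle (k%:R / m%:R) = (1, 0) :> plane.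
    have [_ w1] := Sx.
    have := ek; rewrite /cmul.
    move: w1; case: (\val x.1).2 => w w' /=; case: (circle _) => c d /= w1 [e1 e2].
    congr pair.
      (* The complex equation (c + i d)(w + i w') = w + i w', multiplied by the conjugate of w + i
         w'; its imaginary part comes next. *)
      transitivity ((w * c - w' * d) * w + (w * d + w' * c) * w').
        by rewrite -[LHS]mulr1 -w1; ring.
      by rewrite e1 e2 -w1 !expr2.
    transitivity ((w * d + w' * c) * w - (w * c - w' * d) * w').
      by rewrite -[LHS]mulr1 -w1; ring.
    by rewrite e1 e2 mulrC subrr.
  have := circle_eq1 _ c1; rewrite divr_ge0 ?ler0n//= ltr_pdivrMr ?ltr0n// mul1r ltr_nat km.
  by move=> /(_ isT)/eqP; rewrite mulf_eq0 invr_eq0 (negbTE mR) orbF pnatr_eq0 => /eqP.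
have l0 : l = 0%N.
  have := congr1 (fun x : X => x.2 : gT) e0.
  rewrite TE /= k0 expg0 invg1 mul1g => /(congr1 (fun g => g * (x.2 : gT)^-1)%g).
  rewrite mulgK mulgV => /eqP; rewrite invg_eq1 -order_dvdn => dvd_l.
  case: (posnP l) => // l_gt0; have := dvdn_leq l_gt0 dvd_l.
  by rewrite leqNgt ln.
by move=> y; rewrite /T /= k0 l0.
Qed.


Let D : set Y := @torus_surface R.

(** The angles are arbitrary choices, harmless on the boundary by the periods [m] and [n] of [s], as
    [F_circle] shows. Inside the disc the angle of the first factor defaults to 0 when none
    exists. *)
Let F (x : X) : Q := to (s (m%:R * xget 0 [set t | circle t = (\val x.1).2],
   n%:R * xget 0 [set t | circle t = (\val x.1).1])) x.2.

(** Parametrises the boundary by the plane, with [m] horizontal units or [n] vertical ones to a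
    turn. [mapA] and [mapB] then become plane steps, and [F] becomes [s] followed by a
    translation. *)
Let Theta (v : plane) (g : gT) : X :=
  (insubY (circle (v.2 / n%:R), circle (v.1 / m%:R)), g : discrete_topology gT).

Let circles_torus t t' : solid_torus_set (circle t, circle t' : plane).
Proof. by split; rewrite circle_sqr. Qed.

Let D_Theta v g : D (Theta v g).1.
Proof. by rewrite /D /torus_surface /= val_insubY// circle_sqr. Qed.

Let Theta_surj x : D x.1 -> exists v, x = Theta v x.2.
Proof.
move=> Dx; have [_ Sx] := solid_torusP x.1.
have [t tE] := circle_surj Dx; have [t' t'E] := circle_surj Sx.
exists (m%:R * t', n%:R * t); rewrite [LHS]surjective_pairing; congr pair.
apply: Y_eq; rewrite val_insubY//= ![_ * _ / _]mulrAC !divff// !mul1r tE t'E.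
by rewrite -surjective_pairing.
Qed.

Let s_iterA k x y : s (x + k%:R, sigma ^+ k * y) = to (s (x, y)) (a ^+ k)%g.
Proof.
elim: k x y => [|k IH] x y.
  by rewrite addr0 mul1r expg0 total_act1.
rewrite -natr1 addrA exprS -mulrA s_horizontal IH.
by rewrite -total_actM expgSr.
Qed.

Let s_iterB k x y : s (x, y + k%:R) = to (s (x, y)) (b ^+ k)%g.
Proof.
elim: k => [|k IH]; first by rewrite addr0 expg0 total_act1.
by rewrite -natr1 addrA s_vertical IH -total_actM expgSr.
Qed.

Let s_periodA (i : int) x y : s (x + m%:R * i%:~R, y) = s (x, y).
Proof.
have per z : s (z + m%:R, y) = s (z, y).
  have := s_iterA m z y.
  rewrite {2}/m exprM sqrr_sign expr1n mul1r => ->.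
  by rewrite /m mulnC expgM expg_order expg1n total_act1.
elim/int_rect: i => [|k IH|k IH]; first by rewrite mulr0 addr0.
- by rewrite -IH -[RHS]per -addrA -addn1 PoszD intrD mulrDr mulr1.
- by rewrite -IH -[LHS]per -addrA -addn1 PoszD opprD intrD mulrBr mulr1 subrK.
Qed.

Let s_periodB (i : int) x y : s (x, y + n%:R * i%:~R) = s (x, y).
Proof.
have per z : s (x, z + n%:R) = s (x, z).
  by rewrite s_iterB expg_order total_act1.
elim/int_rect: i => [|k IH|k IH]; first by rewrite mulr0 addr0.
- by rewrite -IH -[RHS]per -addrA -addn1 PoszD intrD mulrDr mulr1.
- by rewrite -IH -[LHS]per -addrA -addn1 PoszD opprD intrD mulrBr mulr1 subrK.
Qed.

Let F_circle y g t t' : (\val y).1 = circle t -> (\val y).2 = circle t' ->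
  F (y, g) = to (s (m%:R * t', n%:R * t)) g.
Proof.
move=> h1 h2; rewrite /F /= h1 h2; congr (to _ _).
have e1 : circle (xget 0 [set u | circle u = circle t]) = circle t :> plane.
  by apply: (@xgetPex _ 0 [set u | circle u = circle t]); exists t.
have e2 : circle (xget 0 [set u | circle u = circle t']) = circle t' :> plane.
  by apply: (@xgetPex _ 0 [set u | circle u = circle t']); exists t'.
have [i ->] := circle_inj (esym e1); have [i' ->] := circle_inj (esym e2).
by rewrite !mulrDr s_periodA s_periodB.
Qed.

Let F_Theta v g : F (Theta v g) = to (s v) g.
Proof.
rewrite (@F_circle _ _ (v.2 / n%:R) (v.1 / m%:R)) ?val_insubY//.
by rewrite !mulrA ![_ * _ / _]mulrAC !divff// !mul1r -surjective_pairing.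
Qed.

Let mapA_Theta v g : mapA (Theta v g) = Theta (v.1 + 1, sigma * v.2) (a^-1 * g)%g.
Proof.
rewrite /mapA /Theta /= val_insubY// /turnA /= expr1 cmul_circle.
congr (insubY (_, _), _).
  by case: (flip); rewrite ?expr1 ?expr0 ?mulN1r ?mul1r ?mulNr ?circleN.
by congr circle; rewrite mulrDl addrC.
Qed.

Let mapB_Theta v g : mapB (Theta v g) = Theta (v.1, v.2 + 1) (b^-1 * g)%g.
Proof.
rewrite /mapB /Theta /= val_insubY// /turnB /= cmul_circle.
by congr (insubY (circle _, _), _); rewrite mulrDl addrC.
Qed.

Let orbit_F x x' : glue_eq r x x' -> D x.1 -> D x'.1 /\ F x' = F x.
Proof.
have FA z : D z.1 -> D (mapA z).1 /\ F (mapA z) = F z.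
  move=> /Theta_surj[v ->]; rewrite mapA_Theta; split; first exact: D_Theta.
  rewrite !F_Theta s_horizontal -surjective_pairing -total_actM.
  by rewrite mulKVg.
have FB z : D z.1 -> D (mapB z).1 /\ F (mapB z) = F z.
  move=> /Theta_surj[v ->]; rewrite mapB_Theta; split; first exact: D_Theta.
  rewrite !F_Theta s_vertical -surjective_pairing -total_actM.
  by rewrite mulKVg.
move=> /glue_T[[k l] ->] Dx; rewrite /T /=.
have [DA FAx] : D (iter k mapA x).1 /\ F (iter k mapA x) = F x.
  by elim: (k : nat) => //= j [Dj <-]; exact: FA.
by rewrite -FAx; elim: (l : nat) => //= j [Dj <-]; exact: FB.
Qed.

Let F_orbit x x' : D x.1 -> D x'.1 -> F x = F x' -> glue_eq r x x'.
Proof.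
move=> /Theta_surj[v ->] /Theta_surj[v' ->]; rewrite !F_Theta.
(* All group coordinates are treated at once. The clause on [E] serves transitivity: it puts [s w]
   and [s u] in one fibre, which supplies the group coordinate of the intermediate point. *)
move=> e0; pose P u u' := E u = E u' /\
  forall g g', to (s u) g = to (s u') g' -> glue_eq r (Theta u g) (Theta u' g').
suff : P v v' by case=> _; exact.
have [h' [_ _ hK _]] := homeomorphism_setT h_homeo.
apply: (@unroll_fiber R flip P); last first.
  apply: (can_inj hK); rewrite -!sE.
  by rewrite -(bundle_proj_act pb _ x.2) e0 (bundle_proj_act pb).
split.
- move=> u; split=> // g g' /(bundle_free pb) ->; exact: glue_eq_refl.
- move=> u w [e1 h1]; split=> // g g' e2; rewrite glue_eq_sym; exact: h1.
- move=> u w z [e1 h1] [e2 h2]; split; first by rewrite e1.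
  move=> g g' e3.
  have /(bundle_transitive pb)[k ek] : p (s w) = p (to (s u) g).
    by rewrite (bundle_proj_act pb) !sE.
  by apply: (@glue_eq_trans _ _ (Theta w k)); [exact: h1|apply: h2; rewrite -ek].
- have sub u w g : w = u -> glue_eq r g w -> glue_eq r g u by move=> ->.
  move=> u w [->|->]; split.
  + by congr h; apply: unroll_step; left.
  + move=> g g'; rewrite s_horizontal -surjective_pairing -total_actM.
    move=> /(bundle_free pb) ->; apply/glue_eqP/rst_step; left.
    by rewrite mapA_Theta mulKg.
  + by congr h; apply: unroll_step; right.
  + move=> g g'; rewrite s_vertical -surjective_pairing -total_actM.
    move=> /(bundle_free pb) ->; apply/glue_eqP/rst_step; right.
    by rewrite mapB_Theta mulKg.
Qed.

Let insubY_continuous (S : topologicalType) (f : S -> plane * plane) :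
  continuous f -> (forall x, solid_torus_set (f x)) ->
  continuous (fun x => insubY (f x)).
Proof.
move=> fc fS; apply: set_type_continuous.
by under eq_fun do rewrite val_insubY//.
Qed.

Let Y_val_continuous : continuous (fun x : X => \val x.1 : plane * plane).
Proof.
move=> x; apply: (@continuous_comp _ _ _ fst (fun y : Y => \val y : plane * plane)).
  exact: cvg_fst.
exact: set_type_val_continuous.
Qed.

Let map_continuous (f : plane * plane -> plane * plane) (g : gT) :
  continuous f -> (forall v, solid_torus_set v -> solid_torus_set (f v)) ->
  continuous (fun x : X => (insubY (f (\val x.1)), (g * x.2)%g) : X).
Proof.
move=> fc fS; apply: cont_pair.
  apply: insubY_continuous => [x|x]; last by apply: fS; exact: solid_torusP.
  by apply: (@continuous_comp _ _ _ (fun x : X => \val x.1 : plane * plane) f);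
    [exact: Y_val_continuous|exact: fc].
move=> x; apply: (@continuous_comp _ _ _ snd
   (fun k : discrete_topology gT => (g * k)%g : discrete_topology gT)).
  exact: cvg_snd.
exact: discrete_continuous.
Qed.

Let T_continuous kl : continuous (T kl).
Proof.
have cA : continuous mapA.
  apply: map_continuous; last exact: turnA_torus.
  by rewrite /turnA /cmul /in_frame; cont.
have cB : continuous mapB.
  apply: map_continuous; last exact: turnB_torus.
  by rewrite /turnB /cmul /in_frame; cont.
move=> x; apply: (@continuous_comp _ _ _ (iter kl.1 mapA) (iter kl.2 mapB)).
  exact: iter_continuous.
exact: iter_continuous.
Qed.

Let Theta_continuous g : continuous (fun v => Theta v g).
Proof.
apply: cont_pair; last exact: cst_continuous.
apply: insubY_continuous => //.
have cc (f : plane -> R) : continuous f -> continuous (fun v => circle (f v)).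
  by move=> fc v; apply: (@continuous_comp _ _ _ f (@circle R));
    [exact: fc|exact: circle_continuous].
by apply: cont_pair; apply: cc; cont.
Qed.

Let E_quotient (U : set M) : open (E @^-1` U) -> open U.
Proof.
have [h' [_ h'c _ h'K]] := homeomorphism_setT h_homeo.
move=> oU; have -> : U = h' @^-1` (h @^-1` U).
  by apply/seteqP; split=> x; rewrite /preimage /= h'K.
move/continuousP: h'c; apply; exact: unroll_quotient oU.
Qed.

Let F_quotient (O : set Q) :
  (forall x, D x.1 -> O (F x) ->
     exists U, [/\ open U, U x & forall x', U x' -> D x'.1 -> O (F x')]) -> open O.
Proof.
move=> hO; apply: (lift_quotient_map pb E_quotient s_cont sE) => g.
apply/openP => v Ov.
have [|U [oU Ux UO]] := hO (Theta v g) (D_Theta v g); first by rewrite F_Theta.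
exists ((fun v => Theta v g) @^-1` U); split=> //.
  by move/continuousP: (@Theta_continuous g); exact.
by move=> v' Uv' /=; rewrite -F_Theta; apply: UO => //; exact: D_Theta.
Qed.

(** Near a boundary point, the angles chosen in [F] may be replaced by the branches [circle_arg]
    without changing the value, by [F_circle]. *)
Let F_continuous : {within [set x : X | D x.1], continuous F}.
Proof.
apply/within_openP => x O Dx oO; have [v ->] := Theta_surj Dx.
move: (x.2 : gT) => g; rewrite F_Theta => Ov.
pose t := v.2 / n%:R; pose t' := v.1 / m%:R.
have tE : n%:R * t = v.2 by rewrite /t mulrCA divff// mulr1.
have t'E : m%:R * t' = v.1 by rewrite /t' mulrCA divff// mulr1.
pose G (z : plane * plane) := to (s (m%:R * circle_arg t' z.2, n%:R * circle_arg t z.1)) g.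
have Gc : {for (circle t, circle t'), continuous G}.
  apply: (@continuous_comp _ _ _ (fun z : plane * plane =>
    (m%:R * circle_arg t' z.2, n%:R * circle_arg t z.1)) (fun v => to (s v) g)).
    apply: continuous_pair.
      apply: (@continuousM _ _ (fun=> m%:R)); first exact: cst_continuous.
      apply: (@continuous_comp _ _ _ snd (circle_arg t')); first exact: cvg_snd.
      exact: circle_arg_continuous.
    apply: (@continuousM _ _ (fun=> n%:R)); first exact: cst_continuous.
    apply: (@continuous_comp _ _ _ fst (circle_arg t)); first exact: cvg_fst.
    exact: circle_arg_continuous.
  exact: (lift_act_continuous pb).
have G0 : G (circle t, circle t') = to (s v) g.
  by rewrite /G /= !circle_arg_self tE t'E -surjective_pairing.
have /cvg_openP/(_ O oO)[|U [oU Uc UO]] := Gc; first by rewrite G0.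
pose V : set (plane * plane) := U `&`
  ([set z | 0 < along (circle t) z.1] `&` [set z | 0 < along (circle t') z.2]).
have oV : open V.
  by apply: openI => //; apply: openI; apply: open_pos; rewrite /along; cont.
have vE : \val (Theta v g).1 = (circle t, circle t') by rewrite val_insubY.
exists ([set y : Y | V (\val y)] `*` [set g]); split.
- by apply: open_slice; exists V.
- split=> //=; rewrite /= vE; split=> //.
  by split; rewrite /= along_self ?circle_sqr.
- move=> [y _] [/= [Uy [y1 y2]] ->] Dy.
  have [_ Sy] := solid_torusP y.
  have := UO _ Uy; rewrite /G.
  by rewrite -(@F_circle y g (circle_arg t (\val y).1) (circle_arg t' (\val y).2))
    ?circle_circle_arg.
Qed.

Lemma torus_klein_extendable_lift : extendable R to.
Proof.
apply: (@extendable_free_quotient R gT Q to Y D r _ T _ _ _ _ _ _ _ _ _ F) => //.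
- exact: solid_torus_hausdorff.
- exact: solid_torus_second_countable.
- exact: solid_torus_compact.
- exact: solid_torus_charted.
- by move=> kl x /(orbit_F (x' := T kl x))[]//; apply/glue_T; exists kl.
- move=> kl [y k] g; rewrite !TE /right_translate /=; congr pair.
  by rewrite !mulgA.
- by move=> [y k] g _; rewrite /F /right_translate /= total_actM.
- move=> q; have [v [k e1]] : exists v k, q = to (s v) k.
    have [h' [_ _ _ h'K]] := homeomorphism_setT h_homeo.
    have [v ev] := unroll_surj (h' (p q)).
    exists v; apply: (bundle_transitive pb).
    by rewrite sE ev h'K.
  by exists (Theta v k); [exact: D_Theta|rewrite F_Theta].
- move=> x x' Dx Dx'; split; first exact: F_orbit.
  by move=> /orbit_F/(_ Dx)[].
Qed.

End TorusKlein.

Lemma torus_klein_extendable (R : realType) (gT : finGroupType)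
    (Q M : topologicalType) (to : {action gT &-> Q}) (p : Q -> M) (flip : bool) :
  homeomorphic (glue (@square_side R flip false)) M ->
  principal_bundle to p -> extendable R to.
Proof.
move=> [h hh] pb.
have [h' [hc _ _ _]] := homeomorphism_setT hh.
pose E v := h (unroll flip v).
have Ec : continuous E.
  move=> v; apply: (@continuous_comp _ _ _ (unroll flip) h); last exact: hc.
  exact: unroll_continuous.
have [s [sc sE]] := plane_lift pb Ec.
have [a sa] : exists a, forall v, s (v.1 + 1, (-1) ^+ flip * v.2) = to (s v) a.
  apply: (plane_lift_const pb sc).
    have cstep : continuous (fun v : R * R => (v.1 + 1, (-1) ^+ flip * v.2 : R)) by cont.
    by move=> v; apply: (@continuous_comp _ _ _ _ s); [exact: cstep|exact: sc].
  by move=> v; rewrite !sE /E; congr h; apply: unroll_step; left.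
have [b sb] : exists b, forall v, s (v.1, v.2 + 1) = to (s v) b.
  apply: (plane_lift_const pb sc).
    have cstep : continuous (fun v : R * R => (v.1, v.2 + 1 : R)) by cont.
    by move=> v; apply: (@continuous_comp _ _ _ _ s); [exact: cstep|exact: sc].
  by move=> v; rewrite !sE /E; congr h; apply: unroll_step; right.
apply: (torus_klein_extendable_lift hh pb sc sE (a := a) (b := b)) => x y.
  exact: (sa (x, y)).
exact: (sb (x, y)).
Qed.

(** * The unit ball of a norm in dimension three *)

Section NormBall.
Variables (R : realType) (N : 'rV[R]_3 -> R).
Hypothesis N_continuous : continuous N.
Hypothesis N_scale : forall (t : R) (v : 'rV[R]_3), N (t *: v) = `|t| * N v.
Hypothesis N_coord : forall (v : 'rV[R]_3) j, `|v ord0 j| <= N v.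
Implicit Types v w : 'rV[R]_3.

Definition norm_ball_set : set 'rV[R]_3 := [set v | N v <= 1].
Definition norm_ball : Type := set_type norm_ball_set.
HB.instance Definition _ := Topological.on norm_ball.

Definition norm_sphere : set norm_ball := [set y | N (\val y) = 1].

Lemma N_gt0 v j : v ord0 j != 0 -> 0 < N v.
Proof. by move=> v0; apply: lt_le_trans (N_coord v j); rewrite normr_gt0. Qed.

Lemma N0 : N 0 = 0.
Proof. by rewrite -(scale0r 0) N_scale normr0 mul0r. Qed.

Lemma norm_ball_set_compact : compact norm_ball_set.
Proof.
have cbox := @rV_compact R 3 (fun=> `[-1, 1]%classic) (fun=> @segment_compact R (-1) 1).
apply: (subclosed_compact _ cbox).
  by apply: (@closed_comp _ _ N [set x | x <= 1]) => [v _|];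
    [exact: N_continuous|exact: closed_le].
move=> v Nv j; rewrite /= in_itv /= -ler_norml.
exact: le_trans (N_coord v j) Nv.
Qed.

Lemma norm_ball_compact : compact [set: norm_ball].
Proof. exact/set_type_compact/norm_ball_set_compact. Qed.

Lemma norm_ball_hausdorff : hausdorff_space norm_ball.
Proof. by apply: set_type_hausdorff; exact: norm_hausdorff. Qed.

Lemma norm_ball0 : norm_ball_set 0.
Proof. by rewrite /norm_ball_set /= N0 ler01. Qed.

Lemma norm_ball_second_countable : second_countable (T := norm_ball).
Proof.
exact: (set_type_second_countable (SigSub (mem_set norm_ball0)) norm_ball_set_compact).
Qed.

(** Cyclic permutation that brings coordinate [i] to the front, the sum of indices being modulo 3;
    it treats the three coordinate directions by one formula. *)
Definition shift_row (i : 'I_3) v : 'rV[R]_3 := \row_j v ord0 (j + i)%R.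

Lemma shift_rowZ i t v : shift_row i (t *: v) = t *: shift_row i v.
Proof. by apply/rowP => j; rewrite !mxE. Qed.

Lemma shift_rowK i v : shift_row i (shift_row (- i) v) = v.
Proof. by apply/rowP => j; rewrite !mxE addrK. Qed.

Lemma shift_rowNK i v : shift_row (- i) (shift_row i v) = v.
Proof. by apply/rowP => j; rewrite !mxE subrK. Qed.

(** Polar coordinates on an open half of the ball: the depth [1 - N] below the sphere, and the
    direction of the ray as ratios to coordinate [i]. For the inverse, [w] is the vector of the line
    with coordinate [i] equal to 1; it is rescaled to the prescribed norm, with the sign [eps]. *)
Lemma sphere_chart (y0 : norm_ball) (i : 'I_3) (eps : R) : eps ^+ 2 = 1 ->
  exists c : boundary_chart R 2 norm_ball,
    chart_dom c = [set y | 0 < eps * (\val y : 'rV[R]_3) ord0 i] /\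
    chart_map c = fun y => row3 (1 - N (\val y))
      (shift_row i (\val y) ord0 idx1 / (\val y : 'rV[R]_3) ord0 i)
      (shift_row i (\val y) ord0 idx2 / (\val y : 'rV[R]_3) ord0 i).
Proof.
move=> eps2; pose x0 : set_type norm_ball_set := y0.
have eps0 : eps != 0 by rewrite -sqrf_eq0 eps2 oner_eq0.
have eps1 : `|eps| = 1.
  by apply/eqP; rewrite -sqr_norm_eq1 eps2.
pose U : set 'rV[R]_3 := [set v | 0 < eps * v ord0 i].
pose V : set 'rV[R]_3 := [set v | 0 < 1 - v ord0 ord0].
pose f v := row3 (1 - N v) (shift_row i v ord0 idx1 / v ord0 i)
  (shift_row i v ord0 idx2 / v ord0 i).
pose w v := shift_row (- i) (row3 1 (v ord0 idx1) (v ord0 idx2)).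
pose g v := (eps * (1 - v ord0 ord0) / N (w v)) *: w v.
have wi v : w v ord0 i = 1.
  by rewrite mxE subrr; exact: row3_0.
have Nw v : 0 < N (w v) by apply: (@N_gt0 _ i); rewrite wi oner_eq0.
have oU : open U by apply: open_pos; cont.
have oV : open V by apply: open_pos; cont.
have Ui v : U v -> v ord0 i != 0.
  by move=> Uv; apply: contraTneq Uv => v0; rewrite /U/= v0 mulr0 ltxx.
have wc : continuous w.
  have rc : continuous (fun v : 'rV[R]_3 => row3 1 (v ord0 idx1) (v ord0 idx2)) by cont.
  apply: row_continuous => j.
  have -> : (fun v => w v ord0 j) =
      (fun v => row3 1 (v ord0 idx1) (v ord0 idx2) ord0 (j - i)%R).
    by apply/funext => v; rewrite [LHS]mxE.
  move=> v; apply: (@continuous_comp _ _ _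
    (fun v : 'rV[R]_3 => row3 1 (v ord0 idx1) (v ord0 idx2)) (fun u => u ord0 (j - i)%R)).
    exact: rc.
  exact: coord_cont.
have [|||v [Vv Hv]|c [dc mc]] :=
    @set_type_chart R 2 _ norm_ball_set x0 U V f g oU oV.
- apply: continuous_in_subspaceT => v /set_mem[_ Uv].
  have vi := Ui _ Uv.
  have shc k : {for v, continuous (fun v => shift_row i v ord0 k / v ord0 i)}.
    apply: continuousM; last by apply: continuousV => //; exact: coord_cont.
    have -> : (fun u => shift_row i u ord0 k) = (fun u : 'rV[R]_3 => u ord0 (k + i)%R).
      by apply/funext => u; rewrite mxE.
    exact: coord_cont.
  have Nc : {for v, continuous (fun v => 1 - N v)}.
    by apply: continuousB; [exact: cst_continuous|exact: N_continuous].
  exact: (row3_continuous_at Nc (shc idx1) (shc idx2)).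
- apply: continuous_subspaceT; apply: row_continuous => j.
  have -> : (fun v => g v ord0 j) =
     fun v => eps * (1 - v ord0 ord0) / N (w v) * w v ord0 j.
    by apply/funext => v; rewrite mxE.
  have Nwc : continuous (fun v => N (w v)).
    by move=> v; apply: continuous_comp; [exact: wc|exact: N_continuous].
  apply: cont_mul.
    apply: cont_mul; first by cont.
    move=> v; apply: continuousV; first by rewrite gt_eqF.
    exact: Nwc.
  move=> v; apply: (@continuous_comp _ _ _ w (fun v => v ord0 j)); first exact: wc.
  exact: coord_cont.
- move=> v Nv Uv; have vi := Ui _ Uv; have Nv0 := N_gt0 vi.
  split.
    by split; rewrite /V /half_space /= row3_0; [rewrite subKr|rewrite subr_ge0].
  have wf : w (f v) = (v ord0 i)^-1 *: v.
    rewrite /w /f row3_1 row3_2.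
    rewrite -[RHS](shift_rowNK i) shift_rowZ; congr shift_row.
    rewrite -[RHS]row3_eta !mxE; congr row3; last by rewrite mulrC.
      by rewrite add0r mulVf.
    by rewrite mulrC.
  rewrite /g wf N_scale scalerA row3_0 subKr normfV.
  have -> : `|v ord0 i| = eps * v ord0 i.
    by rewrite -[RHS]gtr0_norm// normrM eps1 mul1r.
  rewrite -[RHS]scale1r; congr (_ *: _).
  have Nv1 : N v != 0 by rewrite gt_eqF.
  by rewrite -eps2; field; rewrite vi Nv1 eps0.
- rewrite /V/= in Vv; have Nwv := Nw v.
  have Nwv1 : N (w v) != 0 by rewrite gt_eqF.
  have c0 : eps * (1 - v ord0 ord0) / N (w v) != 0.
    by rewrite !mulf_neq0 ?invr_eq0// gt_eqF.
  have Ng : N (g v) = 1 - v ord0 ord0.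
    rewrite /g N_scale normrM normfV normrM eps1 mul1r.
    by rewrite (gtr0_norm Vv) (gtr0_norm Nwv) divfK.
  split.
  + by rewrite /norm_ball_set /= Ng gerBl.
  + rewrite /U /= mxE wi mulr1 !mulrA -expr2 eps2 mul1r.
    by rewrite divr_gt0.
  + have sg k : shift_row i (g v) ord0 k = eps * (1 - v ord0 ord0) / N (w v) *
        row3 1 (v ord0 idx1) (v ord0 idx2) ord0 k.
      by rewrite /g shift_rowZ {2}/w shift_rowK [LHS]mxE.
    have gi : g v ord0 i = eps * (1 - v ord0 ord0) / N (w v).
      by rewrite [LHS]mxE wi mulr1.
    rewrite /f Ng subKr !sg gi row3_1 row3_2 mulrC mulKf//.
    by rewrite mulrC mulKf// row3_eta.
- by exists c; rewrite dc mc.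
Qed.

Lemma norm_ball_charted : charted (R := R) 2 norm_sphere.
Proof.
move=> y0; have := set_valP y0; rewrite /norm_ball_set /= le_eqVlt.
pose x0 : set_type norm_ball_set := y0.
move=> /predU1P[Ny|Ny].
- have [i yi] : exists i, (\val y0 : 'rV[R]_3) ord0 i != 0.
    apply/existsP; apply: contra_eqT Ny => /existsPn y00.
    have -> : \val y0 = 0 :> 'rV[R]_3.
      by apply/rowP => j; move/negbNE/eqP: (y00 j) => ->; rewrite mxE.
    by rewrite N0 eq_sym oner_eq0.
  have sg2 : Num.sg ((\val y0 : 'rV[R]_3) ord0 i) ^+ 2 = 1 by rewrite sqr_sg yi.
  have [c [dc mc]] := sphere_chart y0 i sg2.
  exists c; rewrite dc mc /=; split; first by rewrite -normrEsg normr_gt0.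
  move=> y _; rewrite row3_0 /norm_sphere /=.
  by split=> [/eqP|->]; rewrite ?subrr// subr_eq0 => /eqP <-.
- pose U : set 'rV[R]_3 := [set v | 0 < 1 - N v].
  (* Interior points again get a translation by 2 into the open half-space; coordinates are below 1
     in absolute value there. *)
  pose g (v : 'rV[R]_3) := row3 (v ord0 ord0 - 2) (v ord0 idx1) (v ord0 idx2).
  pose V : set 'rV[R]_3 := [set v | 0 < 1 - N (g v)].
  pose f (v : 'rV[R]_3) := row3 (v ord0 ord0 + 2) (v ord0 idx1) (v ord0 idx2).
  have gc : continuous g by rewrite /g; cont.
  have oU : open U.
    by apply: open_pos => v; apply: continuousB; [exact: cst_continuous|exact: N_continuous].
  have oV : open V.
    apply: open_pos => v; apply: continuousB; first exact: cst_continuous.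
    by apply: continuous_comp; [exact: gc|exact: N_continuous].
  have gf v : g (f v) = v by rewrite /g /f row3_0 row3_1 row3_2 addrK row3_eta.
  have fg v : f (g v) = v by rewrite /g /f row3_0 row3_1 row3_2 subrK row3_eta.
  have pos v : U v -> 0 < v ord0 ord0 + 2.
    rewrite /U /= subr_gt0 => Nv.
    have : `|v ord0 ord0| < 1 by apply: le_lt_trans Nv.
    by rewrite ltr_norml => /andP[]; lra.
  have [||v _ Uv|v [Vv Hv]|c [dc mc]] :=
      @set_type_chart R 2 _ norm_ball_set x0 U V f g oU oV.
  + by apply: continuous_subspaceT; rewrite /f; cont.
  + exact: continuous_subspaceT.
  + split; last exact: gf.
    by split; [rewrite /V/= gf|rewrite /half_space /= row3_0 ltW// pos].
  + by split; [rewrite /norm_ball_set /= -subr_ge0 ltW|exact: Vv|exact: fg].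
  + exists c; rewrite dc mc; split; first by rewrite /U /= subr_gt0.
    move=> y Uy; rewrite row3_0 /norm_sphere /=; split.
      by move/eqP; rewrite gt_eqF//; exact: pos Uy.
    by move=> e; move: Uy; rewrite /U /= e subrr ltxx.
Qed.

End NormBall.

(** * Bundles over the projective plane *)

Section BipyramidNorm.
Variable R : realType.
Implicit Types v : 'rV[R]_3.

(* The unit sphere of this norm is made of two copies of the square [-1, 1]^2,
   glued along its boundary; the antipodal map exchanges the two copies. *)
Definition bipyramid_norm v : R :=
  Num.max `|v ord0 ord0| `|v ord0 idx1| + `|v ord0 idx2|.

Lemma bipyramid_norm_continuous : continuous bipyramid_norm.
Proof.
have nc i : continuous (fun v : 'rV[R]_3 => `|v ord0 i|).
  move=> v; apply: (@continuous_comp _ _ _ (fun v : 'rV[R]_3 => v ord0 i)).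
    exact: coord_cont.
  exact: norm_continuous.
apply: (@cont_add _ _ (fun v => Num.max `|v ord0 ord0| `|v ord0 idx1|)); last exact: nc.
by move=> v; apply: (@continuous_max _ _ (fun v : 'rV[R]_3 => `|v ord0 ord0|));
  exact: nc.
Qed.

Lemma bipyramid_norm_scale t v : bipyramid_norm (t *: v) = `|t| * bipyramid_norm v.
Proof.
by rewrite /bipyramid_norm !mxE !normrM -maxr_pMr// mulrDr.
Qed.

Lemma bipyramid_norm_coord v j : `|v ord0 j| <= bipyramid_norm v.
Proof.
rewrite /bipyramid_norm; have [h0 h1] : `|v ord0 ord0| <= Num.max `|v ord0 ord0| `|v ord0 idx1| /\
    `|v ord0 idx1| <= Num.max `|v ord0 ord0| `|v ord0 idx1|.
  by rewrite !le_max !lexx orbT.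
have h2 := normr_ge0 (v ord0 idx2); have h3 := normr_ge0 (v ord0 idx1).
case: j => -[|[|[|//]]] hj; set u := v ord0 _.
- by have -> : u = v ord0 ord0; [congr (v _ _); exact: val_inj|lra].
- by have -> : u = v ord0 idx1; [congr (v _ _); exact: val_inj|lra].
- by have -> : u = v ord0 idx2; [congr (v _ _); exact: val_inj|lra].
Qed.

Lemma bipyramid_normN v : bipyramid_norm (- v) = bipyramid_norm v.
Proof. by rewrite -scaleN1r bipyramid_norm_scale normrN1 mul1r. Qed.

End BipyramidNorm.

Section AntipodalSquare.
Variables (R : realType) (M : topologicalType).
Variable h : projective_plane R -> M.
Hypothesis h_homeo : homeomorphism setT setT h.
Local Notation sq := (@square_pi R true true).

(** Recentring the square at the origin turns both side identifications into [v ~ - v]. *)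
Definition antipodal_square (v : R * R) : M := h (sq ((v.1 + 1) / 2, (v.2 + 1) / 2)).
Local Notation e := antipodal_square.

Lemma antipodal_square_continuous : continuous e.
Proof.
have [h' [hc _ _ _]] := homeomorphism_setT h_homeo.
have ac : continuous (fun v : R * R => ((v.1 + 1) / 2, (v.2 + 1) / 2 : R)) by cont.
move=> v; apply: (@continuous_comp _ _ _ (fun v : R * R => sq ((v.1 + 1) / 2, (v.2 + 1) / 2)) h);
  last exact: hc.
apply: (@continuous_comp _ _ _ (fun v : R * R => ((v.1 + 1) / 2, (v.2 + 1) / 2)) sq).
  exact: ac.
exact: square_pi_continuous.
Qed.

Lemma antipodal_square_surj m : exists v, e v = m.
Proof.
have [h' [_ _ _ h'K]] := homeomorphism_setT h_homeo.
have [a am] := glue_pi_surj (h' m).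
exists (2 * \val a.1 - 1, 2 * \val a.2 - 1); rewrite /e /=.
rewrite !subrK ![2 * _]mulrC !mulfK ?pnatr_eq0//.
by rewrite square_pi_val am h'K.
Qed.

Lemma antipodal_square_quotient (U : set M) : open (e @^-1` U) -> open U.
Proof.
have [h' [_ h'c _ h'K]] := homeomorphism_setT h_homeo.
move=> oU; have -> : U = h' @^-1` (h @^-1` U).
  by apply/seteqP; split=> x; rewrite /preimage /= h'K.
have ac : continuous (fun v : R * R => (2 * v.1 - 1, 2 * v.2 - 1 : R)) by cont.
move/continuousP: h'c; apply.
apply: (@square_pi_quotient R true true _
  ((fun v : R * R => (2 * v.1 - 1, 2 * v.2 - 1)) @^-1` (e @^-1` U))).
  by move/continuousP: ac; exact.
move=> v _ _; rewrite /preimage /= /e /=.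
by rewrite !subrK ![2 * _]mulrC !mulfK ?pnatr_eq0// -surjective_pairing.
Qed.

Lemma antipodal_square_vertical y : e (1, y) = e (-1, - y).
Proof.
rewrite /e /= addNr mul0r square_pi_vertical; congr (h (sq (_, _))); first by field.
by field.
Qed.

Lemma antipodal_square_horizontal x : e (x, 1) = e (- x, -1).
Proof.
rewrite /e /= addNr mul0r square_pi_horizontal; congr (h (sq (_, _))); first by field.
by field.
Qed.

Lemma antipodal_square_fiber v w :
  -1 <= v.1 <= 1 -> -1 <= v.2 <= 1 -> -1 <= w.1 <= 1 -> -1 <= w.2 <= 1 ->
  e v = e w ->
  v = w \/ w = (- v.1, - v.2) /\ (`|v.1| = 1 \/ `|v.2| = 1).
Proof.
have [h' [_ _ hK _]] := homeomorphism_setT h_homeo.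
move=> v1 v2 w1 w2 /(can_inj hK) evw.
pose dbl (u : R * R) := (2 * u.1 - 1, 2 * u.2 - 1).
pose P' (v w : R * R) := v = w \/ w = (- v.1, - v.2) /\ (`|v.1| = 1 \/ `|v.2| = 1).
pose P u u' := P' (dbl u) (dbl u').
have half_itv (x : R) : -1 <= x <= 1 -> 0 <= (x + 1) / 2 <= 1.
  by move=> /andP[? ?]; apply/andP; split; lra.
have dblK (u : R * R) : dbl ((u.1 + 1) / 2, (u.2 + 1) / 2) = u.
  by rewrite /dbl /= ![2 * _]mulrC !divfK ?pnatr_eq0// !addrK -surjective_pairing.
have := @square_pi_fiber R true true P _ _ _ _ _
  ((v.1 + 1) / 2, (v.2 + 1) / 2) ((w.1 + 1) / 2, (w.2 + 1) / 2)
  (half_itv _ v1) (half_itv _ v2) (half_itv _ w1) (half_itv _ w2) evw.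
rewrite /P !dblK; apply.
- by move=> u; left.
- move=> u u'; move: (dbl u) (dbl u') => a b [->|[-> nu]]; first by left.
  by right; rewrite /= !opprK !normrN -surjective_pairing.
- move=> u1 u2 u3; rewrite /P'; move: (dbl u1) (dbl u2) (dbl u3) => a b c.
  move=> [->//|[-> na]] [<-|[-> nb]]; first by right.
  by left; rewrite /= !opprK -surjective_pairing.
- move=> y; right; rewrite /dbl /=; split; last by left; rewrite mulr0 sub0r normrN1.
  by congr pair; ring.
- move=> x; right; rewrite /dbl /=; split; last by right; rewrite mulr0 sub0r normrN1.
  by congr pair; ring.
Qed.

Lemma antipodal_square_clamp v : e (clamp (-1) 1 v.1, clamp (-1) 1 v.2) = e v.
Proof.
have cl (x : R) : uclamp ((clamp (-1) 1 x + 1) / 2) = uclamp ((x + 1) / 2).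
  apply: val_inj; rewrite !val_uclamp.
  have [x0|x0] := leP x (-1).
    have -> : clamp (-1) 1 x = -1 by rewrite /clamp min_l ?max_l//; lra.
    by rewrite addNr mul0r !clamp_le0//; lra.
  have [x1|x1] := leP x 1; first by rewrite (@clamp_id _ (-1) 1)// ltW.
  have -> : clamp (-1) 1 x = 1 by rewrite /clamp min_r ?max_r//; lra.
  by rewrite !clamp_ge1//; lra.
by rewrite /e /square_pi /= !cl.
Qed.

End AntipodalSquare.

Section ProjectivePlane.
Context {R : realType} {gT : finGroupType} {Q M : topologicalType}.
Variables (to : {action gT &-> Q}) (p : Q -> M).
Variable h : projective_plane R -> M.
Hypothesis h_homeo : homeomorphism setT setT h.
Hypothesis pb : principal_bundle to p.
Local Notation e := (antipodal_square h).
Local Notation N := (@bipyramid_norm R).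
Local Notation plane := (R * R)%type.

Variable s : plane -> Q.
Hypothesis s_cont : continuous s.
Hypothesis sE : forall v, p (s v) = e v.
Variable k : gT.
Hypothesis k_neq1 : k <> 1%g.
Hypothesis k_sqr : (k * k = 1)%g.
Hypothesis s_vertical : forall y, s (-1, - y) = to (s (1, y)) k.
Hypothesis s_horizontal : forall x, s (- x, -1) = to (s (x, 1)) k.

Local Notation Y := (norm_ball N).
Local Notation X := (norm_ball N * discrete_topology gT)%type.

Let kV : (k^-1 = k)%g.
Proof. by apply/eqP; rewrite eq_sym eq_mulgV1 invgK k_sqr. Qed.

Let s_antipodal (v : plane) : `|v.1| = 1 \/ `|v.2| = 1 ->
  s (- v.1, - v.2) = to (s v) k.
Proof.
have kk q q' : q = to q' k -> q' = to q k by move=> ->; rewrite -total_actM k_sqr total_act1.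
have n1 (x : R) : `|x| = 1 -> x = 1 \/ x = -1.
  by move=> /eqP; rewrite eqr_norml ler01 andbT => /orP[]/eqP ->; [left|right].
case: v => x y /= [/n1[] ->|/n1[] ->].
- exact: s_vertical.
- by rewrite opprK; apply: kk; have := s_vertical (- y); rewrite opprK.
- exact: s_horizontal.
- by rewrite opprK; apply: kk; have := s_horizontal (- x); rewrite opprK.
Qed.

Let insubY (v : 'rV[R]_3) : Y :=
  insubd (SigSub (mem_set (norm_ball0 (@bipyramid_norm_scale R))) : Y) v.

Let val_insubY v : N v <= 1 -> \val (insubY v) = v.
Proof. by move=> Nv; rewrite /insubY insubdK//; exact: mem_set. Qed.

Let Y_eq (y y' : Y) : \val y = \val y' :> 'rV[R]_3 -> y = y'.
Proof. exact: val_inj. Qed.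

Let NY (y : Y) : N (\val y) <= 1.
Proof. by have : norm_ball_set N (\val y) by exact: set_valP. Qed.

Let antipode (x : X) : X := (insubY (- \val x.1), (k^-1 * x.2)%g).

Let antipodeK x : antipode (antipode x) = x.
Proof.
rewrite [RHS]surjective_pairing /antipode /= val_insubY ?bipyramid_normN ?NY//.
rewrite kV mulgA k_sqr mul1g; congr pair.
by apply: Y_eq; rewrite opprK val_insubY ?NY.
Qed.

Let r (x y : X) := y = antipode x.
Let T (b : bool) (x : X) : X := if b then antipode x else x.

Let glue_T x y : glue_eq r x y <-> exists b, y = T b x.
Proof.
apply: (iff_trans (glue_eqP _ _ _)); split=> [|[[] ->]].
- elim=> {x y} [x y ->|x|x y _ [[] ->]|x y z _ [b ->] _ [c ->]].
  + by exists true.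
  + by exists false.
  + by exists true; rewrite /= antipodeK.
  + by exists false.
  + by exists (b (+) c); case: b; case: c; rewrite //= antipodeK.
- exact: rst_step.
- exact: rst_refl.
Qed.

Let T_free b x : T b x = x -> forall y, T b y = y.
Proof.
case: b => // /(congr1 (fun z : X => z.2 * (x.2 : gT)^-1)%g).
by rewrite /= mulgK mulgV kV => /k_neq1.
Qed.

Let D : set Y := @norm_sphere R N.

(** The upper half of the sphere is projected vertically to the square and lifted by [s]. The lower
    half goes through the antipode, corrected by [k]; the two formulas agree on the equator by
    [s_antipodal]. *)
Let lift (v : 'rV[R]_3) : Q :=
  if - v ord0 idx2 <= 0 then s (v ord0 ord0, v ord0 idx1)
  else to (s (- v ord0 ord0, - v ord0 idx1)) k.

Let equator v : N v = 1 -> v ord0 idx2 = 0 -> `|v ord0 ord0| = 1 \/ `|v ord0 idx1| = 1.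
Proof.
rewrite /bipyramid_norm => + v2; rewrite v2 normr0 addr0.
by case: leP => _ ->; [right|left].
Qed.

Let lift_antipode v : N v = 1 -> lift (- v) = to (lift v) k.
Proof.
move=> Nv; rewrite /lift !mxE !opprK oppr_le0.
case: (ltgtP (v ord0 idx2) 0) => v2.
- by rewrite -total_actM k_sqr total_act1.
- by [].
- by apply: (s_antipodal (v := (_, _))); exact: equator.
Qed.

Let F (x : X) : Q := to (lift (\val x.1)) x.2.

Let F_antipode x : D x.1 -> F (antipode x) = F x.
Proof.
move=> Dx; rewrite /F /= val_insubY ?bipyramid_normN ?NY// lift_antipode//.
by rewrite -total_actM mulKVg.
Qed.

Let D_antipode x : D x.1 -> D (antipode x).1.
Proof. by move=> Dx; rewrite /D /norm_sphere /= val_insubY bipyramid_normN ?NY. Qed.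

Let c11 (x : R) := clamp (-1) 1 x.

(** Inverse of the vertical projection of the upper half; the height is what brings the norm to
    1. *)
Let up (v : plane) : 'rV[R]_3 :=
  row3 (c11 v.1) (c11 v.2) (1 - Num.max `|c11 v.1| `|c11 v.2|).

Let c11_norm x : `|c11 x| <= 1.
Proof. by rewrite ler_norml; apply: clamp_itv; lra. Qed.

Let up_ge0 v : 0 <= 1 - Num.max `|c11 v.1| `|c11 v.2|.
Proof. by rewrite subr_ge0 ge_max !c11_norm. Qed.

Let N_up v : N (up v) = 1.
Proof.
by rewrite /bipyramid_norm /up row3_0 row3_1 row3_2 (ger0_norm (up_ge0 v)) addrC subrK.
Qed.

Let Theta (v : plane) (g : gT) : X := (insubY (up v), g : discrete_topology gT).

Let D_Theta v g : D (Theta v g).1.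
Proof. by rewrite /D /norm_sphere /= val_insubY N_up. Qed.

(** Both sides lift the same map, which ignores clamping, and they agree at the origin. *)
Let s_clamp v : s (c11 v.1, c11 v.2) = s v.
Proof.
have cc : continuous (fun v : plane => (c11 v.1, c11 v.2)).
  apply: cont_pair => u.
    by apply: (@continuous_comp _ _ _ fst c11); [exact: cvg_fst|exact: clamp_continuous].
  by apply: (@continuous_comp _ _ _ snd c11); [exact: cvg_snd|exact: clamp_continuous].
have [|||g sg] := @plane_lift_const gT Q M to p R s (fun v => s (c11 v.1, c11 v.2)) pb.
- exact: s_cont.
- by move=> u; apply: (@continuous_comp _ _ _ _ s); [exact: cc|exact: s_cont].
- by move=> u; rewrite !sE antipodal_square_clamp.
have g1 : g = 1%g.
  apply/esym/(bundle_free pb (q := s (0, 0))); rewrite -sg /= total_act1.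
  by rewrite /c11 clamp_id//; apply/andP; split; lra.
by rewrite sg g1 total_act1.
Qed.

Let F_Theta v g : F (Theta v g) = to (s v) g.
Proof.
rewrite /F /= val_insubY ?N_up// /lift {1}/up row3_2 oppr_le0 up_ge0.
by rewrite /up row3_0 row3_1 (s_clamp v).
Qed.

Let Theta_surj x : D x.1 -> 0 <= (\val x.1 : 'rV[R]_3) ord0 idx2 ->
  x = Theta ((\val x.1 : 'rV[R]_3) ord0 ord0, (\val x.1 : 'rV[R]_3) ord0 idx1) x.2.
Proof.
move=> Dx x2; rewrite [LHS]surjective_pairing; congr pair; apply: Y_eq.
have cl j : c11 ((\val x.1 : 'rV[R]_3) ord0 j) = (\val x.1 : 'rV[R]_3) ord0 j.
  apply: clamp_id; rewrite -ler_norml.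
  by rewrite (le_trans (bipyramid_norm_coord _ _)).
rewrite val_insubY ?N_up// /up /= !cl -[LHS]row3_eta; congr row3.
by rewrite -[X in X - _]Dx /bipyramid_norm (ger0_norm x2) addrC addKr.
Qed.

Let coord_itv (x : X) j : -1 <= (\val x.1 : 'rV[R]_3) ord0 j <= 1.
Proof. by rewrite -ler_norml (le_trans (bipyramid_norm_coord _ _)). Qed.

Let F_inj_upper x x' : D x.1 -> D x'.1 ->
  0 <= (\val x.1 : 'rV[R]_3) ord0 idx2 -> 0 <= (\val x'.1 : 'rV[R]_3) ord0 idx2 ->
  F x = F x' -> glue_eq r x x'.
Proof.
move=> Dx Dx' x2 x'2; rewrite (Theta_surj Dx x2) (Theta_surj Dx' x'2) !F_Theta.
have := coord_itv x; have := coord_itv x'.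
move: {Dx x2} (\val x.1 : 'rV[R]_3) (x.2 : gT) => v g.
move: {Dx' x'2} (\val x'.1 : 'rV[R]_3) (x'.2 : gT) => v' g' v'1 v1 e0.
have ev : e (v ord0 ord0, v ord0 idx1) = e (v' ord0 ord0, v' ord0 idx1).
  by rewrite -!sE -(bundle_proj_act pb _ g) e0 (bundle_proj_act pb).
have [vv'|[vv' vb]] := antipodal_square_fiber h_homeo (v := (_, _)) (w := (_, _))
  (v1 _) (v1 _) (v'1 _) (v'1 _) ev.
  by move: e0; rewrite vv' => /(bundle_free pb) ->; exact: glue_eq_refl.
apply/glue_T; exists true.
move: e0; rewrite vv' (s_antipodal vb) -total_actM => /(bundle_free pb) ->.
rewrite /T /antipode /Theta /= mulKg val_insubY ?N_up//; congr (insubY _, _).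
have cl j : c11 (v ord0 j) = v ord0 j by rewrite /c11 clamp_id.
have clN j : c11 (- v ord0 j) = - v ord0 j.
  rewrite /c11 clamp_id//; have /andP[] := v1 j.
  by move=> ? ?; apply/andP; split; lra.
rewrite /up /= !cl !clN !normrN.
(* Identified distinct points lie on the boundary of the square, where the height is 0, so the
   antipode stays in the closed upper half. *)
have -> : Num.max `|v ord0 ord0| `|v ord0 idx1| = 1.
  have [n0 n1] : `|v ord0 ord0| <= 1 /\ `|v ord0 idx1| <= 1 by rewrite !ler_norml.
  by apply/eqP; rewrite eq_le ge_max n0 n1 le_max;
    case: vb => /= ->; rewrite lexx ?orbT.
by rewrite -[RHS]row3_eta !mxE /= subrr oppr0.
Qed.

Let F_inj x x' : D x.1 -> D x'.1 -> F x = F x' -> glue_eq r x x'.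
Proof.
have flip y : D y.1 -> exists y', [/\ D y'.1, 0 <= (\val y'.1 : 'rV[R]_3) ord0 idx2,
    F y' = F y & glue_eq r y y'].
  move=> Dy; have [y2|y2] := leP 0 ((\val y.1 : 'rV[R]_3) ord0 idx2).
    by exists y; split=> //; exact: glue_eq_refl.
  exists (antipode y); split; [exact: D_antipode| |exact: F_antipode|].
    by rewrite val_insubY ?bipyramid_normN ?NY// mxE oppr_ge0 ltW.
  by apply/glue_T; exists true.
move=> /flip[y [Dy y2 Fy xy]] /flip[y' [Dy' y'2 Fy' xy']] Fxx'.
apply: glue_eq_trans xy _; rewrite glue_eq_sym.
apply: glue_eq_trans xy' _; rewrite glue_eq_sym.
by apply: F_inj_upper => //; rewrite Fy Fy'.
Qed.

Let insubY_continuous (S : topologicalType) (f : S -> 'rV[R]_3) :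
  continuous f -> (forall x, N (f x) <= 1) -> continuous (fun x => insubY (f x)).
Proof.
move=> fc fN; apply: set_type_continuous.
have -> : (fun x => \val (insubY (f x))) = f by apply/funext => x; rewrite val_insubY.
exact: fc.
Qed.

Let val_continuous : continuous (fun x : X => \val x.1 : 'rV[R]_3).
Proof.
move=> x; apply: (@continuous_comp _ _ _ fst (fun y : Y => \val y : 'rV[R]_3)).
  exact: cvg_fst.
exact: set_type_val_continuous.
Qed.

Let T_continuous b : continuous (T b).
Proof.
case: b => x; last exact: cvg_id.
move: x; apply: cont_pair.
  apply: insubY_continuous => [x|x]; last by rewrite bipyramid_normN NY.
  apply: (@continuous_comp _ _ _ (fun x : X => \val x.1 : 'rV[R]_3) -%R).
    exact: val_continuous.
  exact: opp_continuous.
move=> x; apply: (@continuous_comp _ _ _ snd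
   (fun g : discrete_topology gT => (k^-1 * g)%g : discrete_topology gT)).
  exact: cvg_snd.
exact: discrete_continuous.
Qed.

Let Theta_continuous g : continuous (fun v => Theta v g).
Proof.
apply: cont_pair; last exact: cst_continuous.
apply: insubY_continuous; last by move=> v; rewrite N_up.
have cc (f : plane -> R) : continuous f -> continuous (fun v => c11 (f v)).
  by move=> fc v; apply: (@continuous_comp _ _ _ f c11); [exact: fc|exact: clamp_continuous].
have f1 : continuous (fun v : plane => v.1) by cont.
have f2 : continuous (fun v : plane => v.2) by cont.
have c1 : continuous (fun v : plane => c11 v.1) by exact: (cc _ f1).
have c2 : continuous (fun v : plane => c11 v.2) by exact: (cc _ f2).
have cn (f : plane -> R) : continuous f -> continuous (fun v => `|f v|).
  by move=> fc v; apply: (@continuous_comp _ _ _ f); [exact: fc|exact: norm_continuous].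
rewrite /up; apply: row3_continuous => //.
apply: cont_add; first exact: cst_continuous.
apply: cont_opp => v.
by apply: (@continuous_max _ _ (fun v : plane => `|c11 v.1|)); [exact: cn|exact: cn].
Qed.

Let F_quotient (O : set Q) :
  (forall x, D x.1 -> O (F x) ->
     exists U, [/\ open U, U x & forall x', U x' -> D x'.1 -> O (F x')]) -> open O.
Proof.
move=> hO.
apply: (lift_quotient_map pb (@antipodal_square_quotient R M h h_homeo) s_cont sE) => g.
apply/openP => v Ov.
have [|U [oU Ux UO]] := hO (Theta v g) (D_Theta v g); first by rewrite F_Theta.
exists ((fun v => Theta v g) @^-1` U); split=> //.
  by move/continuousP: (@Theta_continuous g); exact.
by move=> v' Uv' /=; rewrite -F_Theta; apply: UO => //; exact: D_Theta.
Qed.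

Let lift_continuous : {within [set v | N v = 1], continuous lift}.
Proof.
have c1 : continuous (fun v : 'rV[R]_3 => s (v ord0 ord0, v ord0 idx1)).
  have cc : continuous (fun v : 'rV[R]_3 => (v ord0 ord0, v ord0 idx1)) by cont.
  by move=> u; apply: (@continuous_comp _ _ _ _ s); [exact: cc|exact: s_cont].
have c2 : continuous (fun v : 'rV[R]_3 => s (- v ord0 ord0, - v ord0 idx1)).
  have cc : continuous (fun v : 'rV[R]_3 => (- v ord0 ord0, - v ord0 idx1)) by cont.
  by move=> u; apply: (@continuous_comp _ _ _ _ s); [exact: cc|exact: s_cont].
apply: (@within_continuous_paste R _ _ _ _ _ (fun v : 'rV[R]_3 => - v ord0 idx2)).
- exact: continuous_subspaceT.
- by apply: continuous_subspaceT; exact: (lift_act_continuous pb).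
- by cont.
- move=> v Nv /eqP; rewrite oppr_eq0 => /eqP v2.
  rewrite (s_antipodal (v := (_, _)) (equator Nv v2)) /=.
  by rewrite -total_actM k_sqr total_act1.
Qed.

Let F_continuous : {within [set x : X | D x.1], continuous F}.
Proof.
apply/within_openP => -[y g] O Dx oO Ox.
have c : {within [set v | N v = 1], continuous (fun v => to (lift v) g)}.
  apply: (@within_comp _ _ _ _ setT lift (to^~ g)) => //.
  by apply: continuous_subspaceT; exact: (bundle_action_continuous pb).
have /within_openP/(_ (\val y) O Dx oO Ox)[U [oU Uy UO]] := c.
exists ([set z : Y | U (\val z)] `*` [set g]); split=> //.
  by apply: open_slice; exists U.
by move=> [z _] [/= Uz ->] Dz; exact: UO.
Qed.

Lemma projective_plane_extendable_lift : extendable R to.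
Proof.
apply: (@extendable_free_quotient R gT Q to Y D r _ T _ _ _ _ _ _ _ _ _ F) => //.
- exact/norm_ball_hausdorff.
- apply: norm_ball_second_countable; [exact: bipyramid_norm_continuous
    |exact: bipyramid_norm_scale|exact: bipyramid_norm_coord].
- apply: norm_ball_compact; [exact: bipyramid_norm_continuous|exact: bipyramid_norm_coord].
- apply: norm_ball_charted; [exact: bipyramid_norm_continuous
    |exact: bipyramid_norm_scale|exact: bipyramid_norm_coord].
- by case=> // x Dx; exact: D_antipode.
- by case=> // -[y g'] g; rewrite /T /antipode /right_translate /= mulgA.
- by move=> [y g'] g _; rewrite /F /right_translate /= total_actM.
- move=> q; have [v ev] := antipodal_square_surj h_homeo (p q).
  have /(bundle_transitive pb)[g ->] : p (s v) = p q by rewrite sE.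
  by exists (Theta v g); [exact: D_Theta|rewrite F_Theta].
- move=> x x' Dx Dx'; split; first exact: F_inj.
  by move=> /glue_T[[] ->] //; rewrite F_antipode.
Qed.

End ProjectivePlane.

Lemma projective_plane_extendable (R : realType) (gT : finGroupType)
    (Q M : topologicalType) (to : {action gT &-> Q}) (p : Q -> M)
    (h : projective_plane R -> M) (x : gT) :
  homeomorphism setT setT h -> principal_bundle to p -> x <> 1%g ->
  has_monodromy to p (fun t => h (core_circle t)) x -> extendable R to.
Proof.
move=> hh pb x1 [f [hf fp fG]].
have [s [sc sE]] := plane_lift pb (antipodal_square_continuous hh).
have cs (u : R -> R * R) : continuous u -> continuous (s \o u).
  by move=> uc t; apply: (@continuous_comp _ _ _ u s); [exact: uc|exact: sc].
have [k1 s1] : exists k, forall y, s (-1, - y) = to (s (1, y)) k.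
  apply: (lift_const pb (s1 := s \o (fun y => (1, y))) (s2 := s \o (fun y => (-1, - y)))).
  - by apply: cs; cont.
  - by apply: cs; cont.
  - by move=> y; rewrite /= !sE antipodal_square_vertical.
have [k2 s2] : exists k, forall y, s (- y, -1) = to (s (y, 1)) k.
  apply: (lift_const pb (s1 := s \o (fun y => (y, 1))) (s2 := s \o (fun y => (- y, -1)))).
  - by apply: cs; cont.
  - by apply: cs; cont.
  - by move=> y; rewrite /= !sE antipodal_square_horizontal.
(* The corner (1, 1) lies on both sides, and either constant carries its lift to that of (-1,
   -1). *)
have k12 : k1 = k2 by apply: (bundle_free pb (q := s (1, 1))); rewrite -s1 -s2.
rewrite -{}k12 in s2.
have kk : (k1 * k1 = 1)%g.
  apply: (bundle_free pb (q := s (1, -1))).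
  by rewrite total_actM -s1 opprK -s2 opprK total_act1.
apply: (projective_plane_extendable_lift hh pb sc sE _ kk s1 s2) => k1_eq1.
(* [sigma] lifts the core circle, and so does [s] along the segment from (-1, 0) to (1, 0). If [k1]
   were 1, the second lift would close up, while the first one ends at its starting point times
   [x^-1]. *)
pose sigma t := f (glue_pi (mapping_torus_side x) (uclamp t, 1%g)).
have fc : continuous f.
  by have [_ c _] := hf; apply/continuous_subspace_setT.
have sigmac : continuous sigma.
  move=> t; apply: (@continuous_comp _ _ _
    (fun t => glue_pi (mapping_torus_side x) (uclamp t, 1%g)) f); last exact: fc.
  apply: (@continuous_comp _ _ _
    (fun t : R => (uclamp t, 1%g : discrete_topology gT)) (glue_pi _)).
    by apply: continuous_pair; [exact: uclamp_continuous|exact: cst_continuous].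
  exact: glue_pi_continuous.
have [c sc'] : exists c, forall t, s (2 * t - 1, 0) = to (sigma t) c.
  apply: (lift_const pb (s1 := sigma) (s2 := s \o (fun t => (2 * t - 1, 0)))) => //.
    by apply: cs; cont.
  move=> t; rewrite /= sE /sigma fp /core_circle /antipodal_square /square_pi /=.
  congr h; congr (glue_pi _ (uclamp _, _)); first by field.
  apply: val_inj; rewrite val_uclamp add0r mul1r clamp_id//.
  by have := @half_unit_interval R; rewrite mem_setE in_itv.
(* The gluing (0, 1) ~ (1, x) makes [sigma 0] the point of coordinate [x] over the end, whereas
   [sigma 1] has coordinate 1. *)
have sigma1 : sigma 1 = to (sigma 0) x^-1%g.
  rewrite /sigma -fG mul1g; congr f; apply/esym/glue_piP/glue_eqP/rst_step.
  split; rewrite ?val_uclamp ?clamp_id ?lexx ?ler01//=.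
  by rewrite mulgV.
have s0 : s (-1, 0) = s (1, 0) by have := s1 0; rewrite oppr0 k1_eq1 total_act1.
have := sc' 0; have := sc' 1.
rewrite mulr0 sub0r mulr1 (_ : 2 - 1 = 1 :> R); last by ring.
rewrite s0 sigma1 => ->; rewrite -total_actM => /(bundle_free pb) xc.
apply: x1; apply/eqP; rewrite -invg_eq1; apply/eqP.
by apply: (mulIg c); rewrite xc mul1g.
Qed.

Theorem proposition4 (R : realType) (gT : finGroupType) :
  (forall (Q M : topologicalType) (to : {action gT &-> Q}) (p : Q -> M),
     homeomorphic (torus R) M \/ homeomorphic (klein_bottle R) M ->
     principal_bundle to p ->
     extendable R to)
  /\
  (forall (Q M : topologicalType) (to : {action gT &-> Q}) (p : Q -> M)
          (h : projective_plane R -> M) (x : gT),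
     homeomorphism setT setT h ->
     principal_bundle to p ->
     (x ^+ 2)%g = 1%g ->
     x <> 1%g ->
     has_monodromy to p (fun t => h (core_circle t)) x ->
     extendable R to).
Proof.
split=> [Q M to p [hM|hM] pb|Q M to p h x hh pb _ x1 hx].
- exact: torus_klein_extendable hM pb.
- exact: torus_klein_extendable hM pb.
- exact: projective_plane_extendable hh pb x1 hx.
Qed.
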